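(* Let $k\geq 2$ be an integer. Then $G_k(2)=2k$. Furthermore, a finite set $S\subset\mathbb{R}^2$ is a $k$-antipodal point set with $\mathrm{card}(S)=2k$ if and only if $\mathbf{P}:=\mathrm{conv}(S)$ is a convex $(2s)$-gon for some $s\leq k$ with $S\subset\mathrm{bd}(\mathbf{P})$, $\mathrm{card}(S)=2k$, and such that each side of $\mathbf{P}$ is parallel to another side of $\mathbf{P}$, with both of these sides containing the same number of points of $S$.
   Context: A finite set $S$ of (distinct) points in $\mathbb{R}^d$ is a $k$-antipodal point set if any $k$ distinct points of $S$ include two points that are antipodal, i.e., that lie on distinct parallel supporting hyperplanes of $\mathrm{conv}(S)$ (one point on each). $G_k(d)$ denotes the largest cardinality of a $k$-antipodal point set in $\mathbb{R}^d$. $\mathrm{bd}$ denotes boundary. *)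

(* Defs.v *)
From HB Require Import structures.
From mathcomp Require Import all_boot all_order all_algebra.
From mathcomp Require Import finmap.
From mathcomp Require Import all_classical all_reals all_analysis.
Set Implicit Arguments.
Unset Strict Implicit.
Unset Printing Implicit Defensive.
Import Order.TTheory GRing.Theory Num.Theory.
Import numFieldNormedType.Exports.
Local Open Scope classical_set_scope.
Local Open Scope ring_scope.

Definition convex_hull (R : realType) (d : nat) (A : set 'rV[R]_d) :
    set 'rV[R]_d :=
  smallest (@convex_set R 'rV[R]_d) A.

Definition bd (R : realType) (d : nat) (A : set 'rV[R]_d) : set 'rV[R]_d :=
  closure A `\` interior A.

Definition dotp (R : realType) (d : nat) (u x : 'rV[R]_d) : R :=
  \sum_(i < d) u 0 i * x 0 i.

Definition level_set (R : realType) (d : nat) (u : 'rV[R]_d) (c : R) :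
    set 'rV[R]_d :=
  [set x | dotp u x = c].

Definition supporting_hyperplane (R : realType) (d : nat)
    (A H : set 'rV[R]_d) : Prop :=
  exists (u : 'rV[R]_d) (c : R),
    [/\ u != 0, H = level_set u c, A `&` H !=set0
      & (forall x, A x -> dotp u x <= c)].

(* A hyperplane counts as parallel to itself. *)
Definition parallel_hyperplanes (R : realType) (d : nat)
    (H1 H2 : set 'rV[R]_d) : Prop :=
  exists (u : 'rV[R]_d) (c1 c2 : R),
    [/\ u != 0, H1 = level_set u c1 & H2 = level_set u c2].

Definition antipodal (R : realType) (d : nat) (S : {fset 'rV[R]_d})
    (p q : 'rV[R]_d) : Prop :=
  exists H1 H2 : set 'rV[R]_d,
    [/\ supporting_hyperplane (convex_hull [set` S]) H1,
        supporting_hyperplane (convex_hull [set` S]) H2,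
        parallel_hyperplanes H1 H2 /\ H1 <> H2,
        H1 p & H2 q].

Definition k_antipodal (R : realType) (d k : nat) (S : {fset 'rV[R]_d}) :
    Prop :=
  forall T : {fset 'rV[R]_d}, (T `<=` S)%fset -> #|` T| = k ->
    exists p q : 'rV[R]_d, [/\ p \in T, q \in T & antipodal S p q].

(* The relation "G_k(d) = n"; it includes that the maximum is attained, so no
   default value is needed where no largest cardinality exists. *)
Definition is_G (R : realType) (k d n : nat) : Prop :=
  (exists S : {fset 'rV[R]_d}, k_antipodal k S /\ #|` S| = n) /\
  (forall S : {fset 'rV[R]_d}, k_antipodal k S -> (#|` S| <= n)%N).

(* V is the set of vertices. Since V is in convex position and has at least
   three points, P is not contained in a line. *)
Definition convex_gon (R : realType) (n : nat) (P : set 'rV[R]_2) : Prop :=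
  (3 <= n)%N /\
  exists V : {fset 'rV[R]_2},
    [/\ #|` V| = n, P = convex_hull [set` V]
      & forall v, v \in V -> ~ convex_hull ([set` V] `\ v) v].

Definition side (R : realType) (P F : set 'rV[R]_2) : Prop :=
  exists H : set 'rV[R]_2,
    [/\ supporting_hyperplane P H, F = P `&` H
      & exists x y, [/\ F x, F y & x <> y]].

(* In the plane hyperplanes are lines; a side spans a unique one. *)
Definition parallel_sides (R : realType) (F1 F2 : set 'rV[R]_2) : Prop :=
  exists H1 H2 : set 'rV[R]_2,
    [/\ F1 `<=` H1, F2 `<=` H2 & parallel_hyperplanes H1 H2].

Definition num_points_on (R : realType) (S : {fset 'rV[R]_2})
    (F : set 'rV[R]_2) : nat :=
  #|` [fset x in S | x \in F]%fset|.

(* Main.v *)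
(** For a direction u let F(u) be the set of points of S maximising u. Two
points are antipodal iff they lie in disjoint faces F(v) and F(-v).

Upper bound: fix u with F(u), F(-u) disjoint. The remaining points split into
those which are only maximal in directions to the left of u and those which
are only maximal to the right. Either part, together with all but one extreme
point of F(u) (or of F(-u)), contains no antipodal pair, hence has fewer than k
points; adding up gives card S <= 2k. If equality holds then
card F(u) = card F(-u), and no point of S is isolated in the antipodality
graph, since deleting it would give a (k-1)-antipodal set. The vertices then
come in opposite pairs, so their number is even.

Conversely, let opposite sides carry equally many points and let T contain no
antipodal pair. Every point lies on exactly one side of which it is not the
last point (counter-clockwise, or clockwise), and T meets at most one of two
opposite sides; so 2 card T <= card S, and equality forces T to contain one of
each two opposite sides entirely. As neighbouring sides share a vertex, T
would then propagate from a side all the way round to the opposite one. *)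

Require Import Defs.
From HB Require Import structures.
From mathcomp Require Import all_boot all_order all_algebra.
From mathcomp Require Import finmap.
From mathcomp Require Import all_classical all_reals all_analysis.
From mathcomp Require Import zify ring lra.
Import Order.TTheory GRing.Theory Num.Theory.
Import numFieldNormedType.Exports.
Local Open Scope classical_set_scope.
Local Open Scope ring_scope.
Set Implicit Arguments.
Unset Strict Implicit.
Unset Printing Implicit Defensive.

(** * Faces, antipodal pairs and independent sets *)

Lemma in_fset_sep (A : choiceType) (S : {fset A}) (P : pred A) (x : A) :
  (x \in [fset y in S | P y]%fset) = (x \in S) && P x.
Proof. by rewrite !inE. Qed.

(* Quarter turn, counter-clockwise for [b = false], clockwise for [b = true].
   Locked because unification otherwise sees through it as a scalar multiple. *)
HB.lock Definition rt (R : realType) (b : bool) (u : 'rV[R]_2) : 'rV[R]_2 :=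
  \row_j ((-1) ^+ b * (if j == 0 then - u 0 1 else u 0 0)).

Section Plane.
Variable R : realType.
Implicit Types (u v w x y z : 'rV[R]_2) (S T X : {fset 'rV[R]_2}).

(** * Inner product and quarter turns in coordinates *)

Lemma dotp2 u x : dotp u x = u 0 0 * x 0 0 + u 0 1 * x 0 1.
Proof.
rewrite /dotp !big_ord_recl big_ord0 addr0.
by rewrite (_ : lift ord0 ord0 = 1) //; apply/val_inj.
Qed.

Lemma row2P u x : u 0 0 = x 0 0 -> u 0 1 = x 0 1 -> u = x.
Proof.
move=> h0 h1; apply/rowP => j.
have [->//|->//] : j = 0 \/ j = 1.
by case: j => -[|[|//]] hj; [left|right]; apply/val_inj.
Qed.

Lemma rt_0 b u : rt b u 0 0 = (-1) ^+ b * - u 0 1.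
Proof. by rewrite rt.unlock mxE. Qed.

Lemma rt_1 b u : rt b u 0 1 = (-1) ^+ b * u 0 0.
Proof. by rewrite rt.unlock mxE. Qed.

Definition rtE := (rt_0, rt_1).

Lemma dotpDl u v x : dotp (u + v) x = dotp u x + dotp v x.
Proof. by rewrite !dotp2 !mxE; ring. Qed.

Lemma dotpDr u x y : dotp u (x + y) = dotp u x + dotp u y.
Proof. by rewrite !dotp2 !mxE; ring. Qed.

Lemma dotpZl c u x : dotp (c *: u) x = c * dotp u x.
Proof. by rewrite !dotp2 !mxE; ring. Qed.

Lemma dotpZr c u x : dotp u (c *: x) = c * dotp u x.
Proof. by rewrite !dotp2 !mxE; ring. Qed.

Lemma dotpNl u x : dotp (- u) x = - dotp u x.
Proof. by rewrite !dotp2 !mxE; ring. Qed.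

Lemma dotpNr u x : dotp u (- x) = - dotp u x.
Proof. by rewrite !dotp2 !mxE; ring. Qed.

Lemma dotp0l x : dotp 0 x = 0.
Proof. by rewrite !dotp2 !mxE; ring. Qed.

Lemma dotpC u x : dotp u x = dotp x u.
Proof. by rewrite !dotp2; ring. Qed.

Definition dotpE := (dotpDl, dotpDr, dotpZl, dotpZr, dotpNl, dotpNr, dotp0l).

Lemma dotp_rtr b u v : dotp u (rt b v) = - dotp (rt b u) v.
Proof. by rewrite !dotp2 !(mxE, rtE); ring. Qed.

Lemma rt_negb b u : rt (~~ b) u = - rt b u.
Proof. by apply: row2P; case: b; rewrite !(mxE, rtE) ?expr0 ?expr1; ring. Qed.

Lemma rtN b u : rt b (- u) = - rt b u.
Proof. by apply: row2P; rewrite !(mxE, rtE); ring. Qed.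

Lemma rtD b u v : rt b (u + v) = rt b u + rt b v.
Proof. by apply: row2P; rewrite !(mxE, rtE); ring. Qed.

Lemma rtZ b c u : rt b (c *: u) = c *: rt b u.
Proof. by apply: row2P; rewrite !(mxE, rtE); ring. Qed.

Lemma rt_rt b u : rt b (rt b u) = - u.
Proof. by apply: row2P; case: b; rewrite !(mxE, rtE) ?expr0 ?expr1; ring. Qed.

Lemma rt_neq0 b u : u != 0 -> rt b u != 0.
Proof.
apply: contra => /eqP h; rewrite -oppr_eq0 -(rt_rt b) h -[X in rt b X](scale0r 0).
by rewrite rtZ scale0r.
Qed.

Lemma dotp_rt_self b u : dotp (rt b u) u = 0.
Proof. by rewrite !dotp2 !(mxE, rtE); ring. Qed.

Lemma dotp_gt0 u : u != 0 -> 0 < dotp u u.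
Proof.
move=> u0; rewrite dotp2 lt_neqAle -!expr2 addr_ge0 ?sqr_ge0 // andbT eq_sym.
apply: contra u0; rewrite paddr_eq0 ?sqr_ge0 // !sqrf_eq0 => /andP[/eqP h0 /eqP h1].
by apply/eqP/row2P; rewrite mxE.
Qed.

(** Expansion in the orthogonal basis [u], [rt b u], whose vectors have the same length; the factor
    [dotp u u] avoids a division. *)
Lemma dotp_decomp b u v x :
  dotp u u * dotp v x =
  dotp u x * dotp u v + dotp (rt b u) x * dotp (rt b u) v.
Proof. by case: b; rewrite !dotp2 !(mxE, rtE) ?expr0 ?expr1; ring. Qed.

Lemma dotp_eq b u x y : u != 0 -> dotp u x = dotp u y ->
  dotp (rt b u) x = dotp (rt b u) y -> x = y.
Proof.
move=> /dotp_gt0 u0 h1 h2.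
have h v : dotp v x = dotp v y.
  by apply: (mulfI (lt0r_neq0 u0)); rewrite !(dotp_decomp b u) h1 h2.
have {}h j : x 0 j = y 0 j.
  have := h (delta_mx 0 j).
  by rewrite /dotp (bigD1 j) // (bigD1 j (P := xpredT)) //= !big1 ?mxE ?eqxx
     ?mul1r ?addr0 // => i /negPf ij; rewrite mxE eqxx ij mul0r.
exact/rowP.
Qed.

Lemma rt_parallel b u v : u != 0 -> dotp (rt b u) v = 0 ->
  v = (dotp u v / dotp u u) *: u.
Proof.
move=> u0 h; have u1 := lt0r_neq0 (dotp_gt0 u0).
apply: (dotp_eq (b := b) u0); rewrite dotpZr.
  by rewrite divfK.
by rewrite h dotp_rt_self mulr0.
Qed.

(** This is F(u). For [u = 0] it is all of [S], hence the recurring hypothesis [u != 0]. *)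
Definition face S u : {fset 'rV[R]_2} :=
  [fset x in S | `[< forall y, y \in S -> dotp u y <= dotp u x >]]%fset.

Lemma faceP S u x :
  reflect (x \in S /\ forall y, y \in S -> dotp u y <= dotp u x)
          (x \in face S u).
Proof.
rewrite !inE /=; apply: (iffP andP) => -[h1 h2]; split => //; exact/asboolP.
Qed.

Lemma face_sub S u x : x \in face S u -> x \in S.
Proof. by case/faceP. Qed.

Lemma face_le S u x y : x \in face S u -> y \in S -> dotp u y <= dotp u x.
Proof. by case/faceP => _; apply. Qed.

Lemma face_eq S u x y : x \in face S u -> y \in face S u -> dotp u y = dotp u x.
Proof.
move=> hx hy; apply: le_anti; rewrite (face_le hx) ?(face_sub hy) //.
by rewrite (face_le hy) // (face_sub hx).
Qed.

Lemma face_eqP S u x y : x \in face S u -> y \in S -> dotp u y = dotp u x ->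
  y \in face S u.
Proof.
by move=> hx hy e; apply/faceP; split => // z hz; rewrite e (face_le hx).
Qed.

Lemma face_scale S c u : 0 < c -> face S (c *: u) = face S u.
Proof.
move=> c0; apply/fsetP => x; apply/faceP/faceP => -[hx h]; split => // y hy;
  by have := h y hy; rewrite !dotpZl ler_pM2l.
Qed.

Lemma face_cone S a b u v x : 0 <= a -> 0 <= b ->
  x \in face S u -> x \in face S v -> x \in face S (a *: u + b *: v).
Proof.
move=> a0 b0 /faceP[xS h1] /faceP[_ h2]; apply/faceP; split => // y yS.
by rewrite !dotpE lerD // ler_wpM2l ?h1 ?h2.
Qed.

Lemma face_addE S u v x y : x \in face S u -> x \in face S v ->
  y \in face S (u + v) -> y \in face S u /\ y \in face S v.
Proof.
move=> hu hv hy; have yS := face_sub hy; have xS := face_sub hu.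
have := face_le hy xS; rewrite !dotpDl => h.
have h1 := face_le hu yS; have h2 := face_le hv yS.
by split; [apply: face_eqP hu yS _|apply: face_eqP hv yS _]; lra.
Qed.

Lemma fset_argmax (A : choiceType) (V : {fset A}) (f : A -> R) a : a \in V ->
  exists2 x : A, x \in V & forall y : A, y \in V -> f y <= f x.
Proof.
move=> aV.
have [x _ h] := @arg_maxP _ _ V [` aV]%fset predT (fun i : V => f (val i)) isT.
exists (val x); first exact: valP.
by move=> y yV; apply: (h [` yV]%fset).
Qed.

Lemma face_ex S u x : x \in S -> exists y, y \in face S u.
Proof.
move=> /(fset_argmax (dotp u))[y yS h].
by exists y; apply/faceP.
Qed.

Lemma face_end S u b x : x \in face S u ->
  exists2 r, r \in face S u &
    forall y, y \in face S u -> dotp (rt b u) y <= dotp (rt b u) r.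
Proof. exact: fset_argmax. Qed.

Lemma face_rt_inj S u b x y : u != 0 -> x \in face S u -> y \in face S u ->
  dotp (rt b u) x = dotp (rt b u) y -> x = y.
Proof. by move=> u0 hx hy; apply: dotp_eq => //; apply: face_eq hy hx. Qed.

(** Antipodality without hyperplanes: the strict inequality keeps the two support lines apart and
    excludes [v = 0]. *)
Definition antip S x y := exists v,
  [/\ x \in face S v, y \in face S (- v) & dotp v y < dotp v x].

Lemma antip_sym S x y : antip S x y -> antip S y x.
Proof.
move=> [v [h1 h2 h3]]; exists (- v); rewrite opprK; split => //.
by rewrite !dotpNl ltrN2.
Qed.

Definition indep S T := forall x y, x \in T -> y \in T -> ~ antip S x y.

(* The last condition only matters for collinear S, where F(v) and F(-v) may coincide. *)
Definition hits S b u x := exists v,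
  [/\ 0 < dotp (rt b u) v, x \in face S v & x \notin face S (- v)].

(** The normal cone of [x] has directions strictly on both sides of the line spanned by [u], so by
    convexity it meets that line. *)
Lemma hits_both S b u x : u != 0 -> hits S b u x -> hits S (~~ b) u x ->
  x \in face S u \/ x \in face S (- u).
Proof.
move=> u0 [v [hv xv xv']] [w [hw xw _]].
move: hw; rewrite rt_negb dotpNl oppr_gt0 => hw.
set a := dotp (rt b u) v in hv; set c := dotp (rt b u) w in hw.
(* These coefficients cancel the component along [rt b u]. *)
have xt : x \in face S ((- c) *: v + a *: w).
  by apply: face_cone => //; rewrite ?oppr_ge0 ltW.
have /(rt_parallel u0) ht : dotp (rt b u) ((- c) *: v + a *: w) = 0.
  by rewrite !dotpE -/a -/c; ring.
move: ht; set t := _ + _ in xt *; set e := _ / _ => ht.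
have [e0|e0|e0] := ltrgtP e 0.
- right; move: xt; rewrite ht (_ : e *: u = (- e) *: (- u)).
    by rewrite face_scale // oppr_gt0.
  by rewrite scalerN scaleNr opprK.
- by left; move: xt; rewrite ht face_scale.
(* If the combination vanishes, [w] is a positive multiple of [- v], against the last condition in
   [hits]. *)
- have hw0 : w = (- c / a) *: (- v).
    have /eqP : t = 0 by rewrite ht e0 scale0r.
    rewrite /t scaleNr addrC subr_eq0 => /eqP h.
    rewrite scalerN mulNr scaleNr opprK mulrC -scalerA -h scalerA mulVf ?scale1r //.
    exact: lt0r_neq0.
  move: xw; rewrite hw0 face_scale ?(negPf xv') //.
  by rewrite divr_gt0 // oppr_gt0.
Qed.

Lemma antip_notin S x y v : x \in face S v -> y \in face S (- v) ->
  dotp v y < dotp v x -> y \notin face S v.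
Proof.
by move=> hx hy h; apply/negP => hy'; move: h; rewrite (face_eq hx hy') ltxx.
Qed.

(* A direction v with a component along [rt b u] can only select r in F(u), and
   selects nothing in X; an antipodal pair needs both v and -v. *)
Lemma arc_indep S b u r X : u != 0 ->
  (forall x, x \in X -> [/\ x \in S, x \notin face S u,
     x \notin face S (- u) & ~ hits S b u x]) ->
  r \in face S u ->
  (forall y, y \in face S u -> dotp (rt b u) y <= dotp (rt b u) r) ->
  (forall x, x \in face S u -> x \notin face S (- u)) ->
  indep S (X `|` (face S u `\ r))%fset.
Proof.
move=> u0 hX rF rmax nd x y hx hy [v [xv yv lt]].
have key z w : z \in (X `|` (face S u `\ r))%fset -> z \in face S w ->
    z \notin face S (- w) -> 0 < dotp (rt b u) w -> False.
  rewrite in_fsetU in_fsetD1 => /orP[/hX[_ _ _ nh] zw zw' pos|].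
    by apply: nh; exists w.
  move=> /andP[/eqP zr zF] zw _ pos; apply: zr.
  apply: (face_rt_inj (b := b) u0 zF rF); apply: le_anti; rewrite rmax //=.
  have := face_le zw (face_sub rF).
  rewrite -(ler_pM2l (dotp_gt0 u0)) !(dotp_decomp b u) (face_eq zF rF) lerD2l.
  by rewrite ler_pM2r.
have yv' : y \notin face S (- - v) by rewrite opprK (antip_notin xv).
have xv' : x \notin face S (- v).
  by apply: (antip_notin yv); rewrite ?opprK // !dotpNl ltrN2.
have [neg|pos|z0] := ltrgtP (dotp (rt b u) v) 0.
- by apply: (key _ _ hy yv yv'); rewrite dotpNr oppr_gt0.
- exact: (key _ _ hx xv xv' pos).
have noF z : z \in (X `|` (face S u `\ r))%fset -> z \notin face S (- u).
  by rewrite in_fsetU in_fsetD1 => /orP[/hX[]//|/andP[_ /nd]].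
move: xv yv xv'; rewrite (rt_parallel u0 z0); set c := _ / _.
have [c0|c0|->] := ltrgtP c 0.
- rewrite (_ : c *: u = (- c) *: (- u)); last by rewrite scalerN scaleNr opprK.
  by rewrite face_scale ?oppr_gt0 // (negPf (noF _ hx)).
- by rewrite -scalerN !face_scale // => _; rewrite (negPf (noF _ hy)).
- by rewrite scale0r oppr0 => ->.
Qed.

(** The independent set omits one extreme point of F(u), which turns the strict bound into
    [<= k]. *)
Lemma arc_card S b u k X : u != 0 -> S != fset0 ->
  (forall T, (T `<=` S)%fset -> indep S T -> (#|` T| < k)%N) ->
  (forall x, x \in X -> [/\ x \in S, x \notin face S u,
     x \notin face S (- u) & ~ hits S b u x]) ->
  (forall x, x \in face S u -> x \notin face S (- u)) ->
  (#|` X| + #|` face S u| <= k)%N.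
Proof.
move=> u0 /fset0Pn[s /(face_ex u)[s' sF]] hk hX nd.
have [r rF rmax] := face_end b sF.
have := hk _ _ (arc_indep u0 hX rF rmax nd).
rewrite (cardfsD1 r (face S u)) rF /= => h.
have -> : (#|` X| + (1 + #|` face S u `\ r|) =
   (#|` X `|` (face S u `\ r)|).+1)%N%fset.
  rewrite cardfsU (_ : X `&` _ = fset0)%fset ?cardfs0; first by lia.
  apply/fsetP => x; rewrite in_fsetI in_fsetD1 in_fset0.
  by apply/negP => /andP[/hX[_ /negPf-> _ _]]; rewrite andbF.
apply: h; apply/fsubsetP => x; rewrite in_fsetU => /orP[/hX[]//|].
by rewrite in_fsetD1 => /andP[_ /face_sub].
Qed.

(** Each of the two parts [A] and [B] of the rest can be joined to F(u) or to F(-u), which gives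
    four bounds by [k]. Pairing [A] with F(u) and [B] with F(-u) bounds card S; in case of equality
    the other pairing is tight too, and comparing the two gives card F(u) = card F(-u). *)
Lemma arc_split S u k : u != 0 -> S != fset0 ->
  (forall T, (T `<=` S)%fset -> indep S T -> (#|` T| < k)%N) ->
  (forall x, x \in face S u -> x \notin face S (- u)) ->
  (#|` S| <= 2 * k)%N /\
  (#|` S| = (2 * k)%N -> #|` face S u| = #|` face S (- u)|).
Proof.
move=> u0 S0 hk nd.
have u0' : - u != 0 by rewrite oppr_eq0.
have nd' x : x \in face S (- u) -> x \notin face S (- - u).
  by rewrite opprK => h; apply/negP => /nd; rewrite h.
pose rest := ((S `\` face S u) `\` face S (- u))%fset.
pose A := [fset x in rest | `[< hits S false u x >]]%fset.
pose B := [fset x in rest | ~~ `[< hits S false u x >]]%fset.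
have hr x : x \in rest -> [/\ x \in S, x \notin face S u & x \notin face S (- u)].
  by rewrite !in_fsetD => /and3P[].
have hA x : x \in A -> [/\ x \in S, x \notin face S u, x \notin face S (- u)
    & ~ hits S true u x].
  rewrite in_fset_sep => /andP[/hr[h1 h2 h3] /asboolP h]; split => //.
  by move=> /(hits_both u0 h)[] /idP; apply/negP.
have hB x : x \in B -> [/\ x \in S, x \notin face S u, x \notin face S (- u)
    & ~ hits S false u x].
  by rewrite in_fset_sep => /andP[/hr[h1 h2 h3] /asboolP h]; split.
have hitsN b x : hits S b (- u) x = hits S (~~ b) u x.
  by rewrite /hits rtN rt_negb.
have hA' x : x \in A -> [/\ x \in S, x \notin face S (- u),
    x \notin face S (- - u) & ~ hits S false (- u) x].
  by rewrite opprK hitsN => /hA[].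
have hB' x : x \in B -> [/\ x \in S, x \notin face S (- u),
    x \notin face S (- - u) & ~ hits S true (- u) x].
  by rewrite opprK hitsN => /hB[].
have := arc_card u0 S0 hk hA nd; have := arc_card u0 S0 hk hB nd.
have := arc_card u0' S0 hk hA' nd'; have := arc_card u0' S0 hk hB' nd'.
have e1 := cardfsID (face S u) S.
have e2 := cardfsID (face S (- u)) (S `\` face S u)%fset.
have e3 : (#|` rest| = #|` A| + #|` B|)%N.
  rewrite -(cardfsID A rest) (_ : rest `&` A = A)%fset.
    rewrite (_ : rest `\` A = B)%fset //; apply/fsetP => x.
    by rewrite in_fsetD !in_fset_sep; case: (x \in rest); rewrite ?andbF ?andbT.
  by apply/fsetP => x; rewrite in_fsetI !in_fset_sep andbA andbb.
have e4 : (S `&` face S u)%fset = face S u.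
  apply/fsetP => x; rewrite in_fsetI andbC; apply: andb_idr; exact: face_sub.
have e5 : ((S `\` face S u) `&` face S (- u))%fset = face S (- u).
  apply/fsetP => x; rewrite in_fsetI in_fsetD andbC; apply: andb_idr => xF.
  rewrite (face_sub xF) andbT; apply/negP => /nd; by rewrite xF.
rewrite e4 in e1; rewrite e5 -/rest in e2.
lia.
Qed.

End Plane.

(** * From convex hulls to faces *)

Section Bridge.
Variable R : realType.
Implicit Types (u v w x y z : 'rV[R]_2) (S T X : {fset 'rV[R]_2}).

Lemma convex_setP (C : set 'rV[R]_2) : convex_set C <->
  forall x y t, C x -> C y -> 0 <= t -> t <= 1 -> C (t *: x + (1 - t) *: y).
Proof.
split => [hC x y t Cx Cy t0 t1|h x y l].
  by have := hC x y (Itv01 t0 t1) (mem_set Cx) (mem_set Cy); rewrite inE.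
rewrite !inE => Cx Cy; exact: h.
Qed.

Lemma convex_hull_min (A C : set 'rV[R]_2) :
  convex_set C -> A `<=` C -> convex_hull A `<=` C.
Proof. exact: smallest_sub. Qed.

Lemma sub_convex_hull (A : set 'rV[R]_2) : A `<=` convex_hull A.
Proof. exact: sub_gen_smallest. Qed.

Lemma convex_hullP (A : set 'rV[R]_2) x y t :
  convex_hull A x -> convex_hull A y -> 0 <= t -> t <= 1 ->
  convex_hull A (t *: x + (1 - t) *: y).
Proof.
move=> hx hy t0 t1 C [hC AC]; move/convex_setP: (hC); apply => //.
  exact: hx.
exact: hy.
Qed.

Lemma convex_hull_convex (A : set 'rV[R]_2) : convex_set (convex_hull A).
Proof. by apply/convex_setP => x y t; apply: convex_hullP. Qed.

Lemma face_hull_le S u x y : x \in face S u ->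
  convex_hull [set` S] y -> dotp u y <= dotp u x.
Proof.
move=> hx; apply: (convex_hull_min (C := [set y | dotp u y <= dotp u x])).
  apply/convex_setP => a b t /= ha hb t0 t1; rewrite !dotpDr !dotpZr; nra.
by move=> z /= /(face_le hx).
Qed.

Lemma convex_hull_lt (A : set 'rV[R]_2) u c :
  A `<=` [set y | dotp u y < c] -> convex_hull A `<=` [set y | dotp u y < c].
Proof.
apply: convex_hull_min; apply/convex_setP => a b t /= ha hb t0 t1.
rewrite !dotpDr !dotpZr.
have [->|t0'] := eqVneq t 0; first by lra.
have {}t0 : 0 < t by rewrite lt_neqAle eq_sym t0'.
nra.
Qed.

(** A support line of the hull touches [S]: were all of [S] strictly below it, the hull would be
    too. *)
Lemma supportingP S (H : set 'rV[R]_2) :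
  supporting_hyperplane (convex_hull [set` S]) H <->
  exists u x, [/\ u != 0, x \in face S u & H = level_set u (dotp u x)].
Proof.
split=> [[u [c [u0 -> [p [/= hp pc]] hle]]]|[u [x [u0 hx ->]]]]; last first.
  exists u, (dotp u x); split => //; last by move=> y; apply: face_hull_le.
  by exists x; split => //; apply: sub_convex_hull; apply: face_sub hx.
have /existsNP [x /not_implyP [xS /negP hx]] :
    ~ (forall x, x \in S -> dotp u x < c).
  move=> h; suff : dotp u p < c by rewrite pc ltxx.
  exact: (convex_hull_lt (c := c)) hp.
have xc : dotp u x = c.
  apply: le_anti; rewrite hle /=; last exact: sub_convex_hull.
  by rewrite leNgt.
exists u, x; rewrite xc; split => //.
apply/faceP; split => // y yS; rewrite xc; apply: hle; exact: sub_convex_hull.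
Qed.

Lemma two_points_parallel u v x y : u != 0 -> x != y ->
  dotp u x = dotp u y -> dotp v x = dotp v y -> exists c, v = c *: u.
Proof.
move=> u0 xy hu hv; exists (dotp u v / dotp u u).
apply: (rt_parallel (b := false) u0); apply/eqP.
have := dotp_decomp false u v (x - y).
rewrite !dotpDr !dotpNr hu hv !subrr mul0r add0r mulr0 => /eqP.
rewrite eq_sym mulf_eq0 subr_eq0 => /orP[/eqP h|//].
by case/eqP: xy; apply: dotp_eq u0 hu h.
Qed.

Lemma level_set_parallel u v c d : u != 0 ->
  level_set u c = level_set v d -> exists e, v = e *: u.
Proof.
move=> u0 h; have u1 := lt0r_neq0 (dotp_gt0 u0).
(* [x] is the foot of the perpendicular from the origin, [y] a second point of the line. *)
pose x := (c / dotp u u) *: u; pose y := x + rt false u.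
have hx : dotp u x = c by rewrite dotpZr divfK.
have hy : dotp u y = c by rewrite dotpDr dotp_rtr dotp_rt_self oppr0 addr0.
apply: (two_points_parallel u0 (x := x) (y := y)).
- by rewrite -subr_eq0 opprD addrA subrr sub0r oppr_eq0 rt_neq0.
- by rewrite hx hy.
- have vx : level_set v d x by rewrite -h.
  have vy : level_set v d y by rewrite -h.
  by rewrite vx vy.
Qed.

Lemma level_setZ u c e : e != 0 -> level_set (e *: u) (e * c) = level_set u c.
Proof.
move=> e0; apply/seteqP; split => x; rewrite /level_set /= dotpZl.
  exact: mulfI.
by move->.
Qed.

Lemma parallel_trans u v w : w != 0 -> v != 0 ->
  (exists e, v = e *: u) -> (exists e, v = e *: w) -> exists e, w = e *: u.
Proof.
move=> w0 v0 [e ev] [f fv]; exists (e / f).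
have f0 : f != 0 by apply: contra v0 => /eqP f0; rewrite fv f0 scale0r.
by rewrite mulrC -scalerA -ev fv scalerA mulVf // scale1r.
Qed.

(** Parallel support lines have proportional outer normals [u] and [e *: u]. A positive [e] would
    make the lines equal, so the normals are opposite. *)
Lemma antipodalP S p q : p \in S -> q \in S ->
  antipodal S p q <-> antip S p q.
Proof.
move=> pS qS; split; last first.
  move=> [v [hp hq lt]].
  have v0 : v != 0 by apply/eqP => v0; move: lt; rewrite v0 !dotp0l ltxx.
  exists (level_set v (dotp v p)), (level_set (- v) (dotp (- v) q)); split => //.
  - by apply/supportingP; exists v, p.
  - by apply/supportingP; exists (- v), q; rewrite oppr_eq0.
  - have e : level_set (- v) (dotp (- v) q) = level_set v (dotp v q).
      by rewrite -scaleN1r dotpZl level_setZ // oppr_eq0 oner_eq0.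
    split; first by exists v, (dotp v p), (dotp v q).
    rewrite e => h; have : level_set v (dotp v q) p by rewrite -h.
    by rewrite /level_set /= => h'; move: lt; rewrite h' ltxx.
move=> [H1 [H2 [/supportingP[u [x [u0 xF hH1]]] /supportingP[v [y [v0 yF hH2]]]
  [[w [c [d [w0 e1 e2]]]] H12] pH qH]]].
have [e ev] : exists e, v = e *: u.
  have [a ha] : exists e, u = e *: w.
    by apply: (@level_set_parallel w u c (dotp u x)) => //; rewrite -e1.
  have [b hb] : exists e, v = e *: w.
    by apply: (@level_set_parallel w v d (dotp v y)) => //; rewrite -e2.
  have a0 : a != 0 by apply: contra u0 => /eqP a0; rewrite ha a0 scale0r.
  by exists (b / a); rewrite ha scalerA divfK.
have e0 : e != 0 by apply: contra v0 => /eqP e0; rewrite ev e0 scale0r.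
have pF : p \in face S u by apply: (face_eqP xF) => //; move: pH; rewrite hH1.
have qF : q \in face S v by apply: (face_eqP yF) => //; move: qH; rewrite hH2.
have hp : H1 = level_set u (dotp u p) by rewrite hH1 (face_eq pF xF).
have hq : H2 = level_set u (dotp u q).
  by rewrite hH2 (face_eq qF yF) ev dotpZl level_setZ.
have pq : dotp u q != dotp u p.
  by apply/eqP => h; apply: H12; rewrite hp hq h.
move: qF; rewrite ev.
have [eneg|epos|ez] := ltrgtP e 0; last by case/eqP: e0.
  rewrite (_ : e *: u = (- e) *: (- u)); last by rewrite scalerN scaleNr opprK.
  rewrite face_scale ?oppr_gt0 // => qF; exists u; split => //.
  by rewrite lt_neqAle pq (face_le pF).
by rewrite face_scale // => qF; case/eqP: pq; exact: face_eq pF qF.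
Qed.

(** * k-antipodality as a bound on independent sets *)

Lemma fsubset_of_card (A : choiceType) (T : {fset A}) (k : nat) :
  (k <= #|` T|)%N -> exists2 T' : {fset A}, (T' `<=` T)%fset & #|` T'| = k.
Proof.
move=> hk; exists [fset x in take k (enum_fset T)]%fset.
  by apply/fsubsetP => x; rewrite inE /= => /mem_take.
by rewrite card_fseq undup_id ?take_uniq ?fset_uniq // size_take_min; apply/minn_idPl.
Qed.

Lemma k_antipodal_indep (k : nat) S : k_antipodal k S <->
  forall T, (T `<=` S)%fset -> indep S T -> (#|` T| < k)%N.
Proof.
split=> [h T TS iT|h T TS Tk].
  rewrite ltnNge; apply/negP => /fsubset_of_card[T' T'T T'k].
  have [p [q [pT qT]]] := h T' (fsubset_trans T'T TS) T'k.
  have [pT' qT'] := (fsubsetP T'T p pT, fsubsetP T'T q qT).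
  by rewrite antipodalP ?(fsubsetP TS) //; apply: iT.
apply: contrapT => hn; suff : (#|` T| < k)%N by rewrite Tk ltnn.
apply: (h T TS) => x y xT yT axy; apply: hn; exists x, y; split => //.
by apply/antipodalP; rewrite ?(fsubsetP TS).
Qed.

Lemma antip_sub S S' x y : (S' `<=` S)%fset -> x \in S' -> y \in S' ->
  antip S x y -> antip S' x y.
Proof.
move=> /fsubsetP sub xS yS [v [/faceP[_ h1] /faceP[_ h2] h3]].
by exists v; split => //; apply/faceP; split => // z /sub; [apply: h1|apply: h2].
Qed.

(** An isolated [z] can be added to any independent set of the other points, so their bound drops by
    one. *)
Lemma isolated_remove S z (k : nat) : z \in S -> (forall y, ~ antip S z y) ->
  (forall T, (T `<=` S)%fset -> indep S T -> (#|` T| < k)%N) ->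
  forall T, (T `<=` S `\ z)%fset -> indep (S `\ z)%fset T -> (#|` T| < k.-1)%N.
Proof.
move=> zS iz hk T /fsubsetP TS iT.
have zT : z \notin T by apply/negP => /TS; rewrite !inE eqxx.
suff : (#|` (z |` T)%fset| < k)%N by rewrite cardfsU1 zT; lia.
apply: hk.
  apply/fsubsetP => x; rewrite in_fset1U => /orP[/eqP->//|/TS].
  by rewrite in_fsetD1 => /andP[].
move=> x y; rewrite !in_fset1U => /orP[/eqP->|xT] /orP[/eqP->|yT].
- exact: iz.
- exact: iz.
- by move/antip_sym; apply: iz.
- move=> h; apply: (iT x y) => //; apply: antip_sub h; rewrite ?fsubD1set //; exact: TS.
Qed.

Lemma face_disjoint S u x y z : x \in S -> y \in S -> dotp u x != dotp u y ->
  z \in face S u -> z \notin face S (- u).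
Proof.
move=> xS yS /eqP xy zF; apply/negP => zF'; apply: xy.
have := face_le zF xS; have := face_le zF yS.
have := face_le zF' xS; have := face_le zF' yS.
by rewrite !dotpNl; lra.
Qed.

Lemma indep_card S (k : nat) :
  (forall T, (T `<=` S)%fset -> indep S T -> (#|` T| < k)%N) ->
  (#|` S| <= 2 * k)%N.
Proof.
(* The empty set is independent, so [k] is positive; this settles sets with at most one point. *)
move=> hk; have k0 : (0 < k)%N.
  have := hk fset0 (fsub0set S); rewrite cardfs0; apply => x y.
  by rewrite in_fset0.
have [S1|S1] := leqP #|` S| 1; first by lia.
have S0 : S != fset0 by rewrite -cardfs_gt0; lia.
have [x xS] := fset0Pn _ S0.
have /fset0Pn[y] : (S `\ x)%fset != fset0.
  by rewrite -cardfs_gt0; move: S1; rewrite (cardfsD1 x) xS.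
rewrite in_fsetD1 => /andP[yx yS].
(* With this direction [dotp u] is not constant on [S], so F(u) and F(-u) are disjoint. *)
have u0 : x - y != 0 by rewrite subr_eq0 eq_sym.
apply: (proj1 (arc_split u0 S0 hk _)) => z.
apply: (face_disjoint xS yS); rewrite -subr_eq0.
by rewrite (_ : _ - _ = dotp (x - y) (x - y)) ?lt0r_neq0 ?dotp_gt0 // dotpDr dotpNr.
Qed.

(** A point in both F(u) and F(-u) would put all of [S] on a line with normal [u]. Below,
    [supported] encodes that [S] lies on the boundary of the hull, and [balanced] compares opposite
    faces of every kind, single points as well as sides. *)
Definition noncollinear S := forall u x, u != 0 -> x \in face S u ->
  x \notin face S (- u).
Definition supported S := forall z, z \in S -> exists2 v, v != 0 & z \in face S v.
Definition balanced S := forall u, u != 0 -> #|` face S u| = #|` face S (- u)|.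

Lemma extremal_structure S (k : nat) : (2 <= k)%N -> #|` S| = (2 * k)%N ->
  (forall T, (T `<=` S)%fset -> indep S T -> (#|` T| < k)%N) ->
  [/\ noncollinear S, supported S & balanced S].
Proof.
move=> k2 Sk hk.
have S0 : S != fset0 by rewrite -cardfs_gt0; lia.
have hA z : z \in S -> exists y, antip S z y.
  move=> zS; apply: contrapT => /forallNP iz.
  (* Deleting an isolated point would leave [2 * k - 1] points, more than [2 * k.-1]. *)
  have := indep_card (isolated_remove zS iz hk).
  by move: Sk; rewrite (cardfsD1 z) zS /=; lia.
(* On a line only the two ends are antipodal, so [S] would have at most two points. *)
have nc : noncollinear S.
  move=> u x u0 hx; apply/negP => hx'.
  have hu y : y \in S -> dotp u y = dotp u x.
    by move=> yS; have := face_le hx yS; have := face_le hx' yS; rewrite !dotpNl; lra.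
  pose w := rt false u; have w0 : w != 0 by apply: rt_neq0.
  have [r1 r1F] := face_ex w (face_sub hx).
  have [r2 r2F] := face_ex (- w) (face_sub hx).
  have uniq z r : z \in S -> r \in S -> dotp w z = dotp w r -> z = r.
    by move=> zS rS; apply: dotp_eq u0 _ => //; rewrite (hu z) ?(hu r).
  have sub : (S `<=` [fset r1; r2])%fset.
    apply/fsubsetP => z zS; have [y [v [zv yv lt]]] := hA z zS.
    (* On the line [dotp v] is affine in the position [dotp w]; the sign of [dotp w v] tells at
       which end [z] lies. *)
    have dv a b : a \in S -> b \in S ->
        dotp u u * (dotp v a - dotp v b) = (dotp w a - dotp w b) * dotp w v.
      move=> aS bS.
      by rewrite mulrBr !(dotp_decomp false u v) (hu a) ?(hu b) //; rewrite -/w; ring.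
    have uu := dotp_gt0 u0; have yS := face_sub yv.
    have lt' : 0 < (dotp w z - dotp w y) * dotp w v.
      by rewrite -dv // mulr_gt0 // subr_gt0.
    have [neg|pos|e] := ltrgtP (dotp w v) 0; last by move: lt'; rewrite e mulr0 ltxx.
      rewrite in_fset2; apply/orP; right; apply/eqP/uniq => //.
        exact: face_sub r2F.
      apply: le_anti; have := face_le r2F zS; rewrite !dotpNl lerN2 => -> /=.
      have := dv z r2 zS (face_sub r2F); have := face_le zv (face_sub r2F).
      by rewrite andbT -subr_ge0 => h1 h2; rewrite -subr_le0; nra.
    rewrite in_fset2; apply/orP; left; apply/eqP/uniq => //.
      exact: face_sub r1F.
    apply: le_anti; rewrite (face_le r1F zS) /=.
    have := dv z r1 zS (face_sub r1F); have := face_le zv (face_sub r1F).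
    by rewrite -subr_ge0 => h1 h2; rewrite -subr_ge0; nra.
  have := fsubset_leq_card sub; rewrite cardfs2 Sk.
  by case: (r1 != r2) => /=; lia.
split => //.
  move=> z /hA[y [v [zv _ lt]]]; exists v => //.
  by apply/eqP => v0; move: lt; rewrite v0 !dotp0l ltxx.
by move=> u u0; apply: (proj2 (arc_split u0 S0 hk (nc u ^~ u0))).
Qed.

End Bridge.

(** * Sides and exposed points *)

Section Sides.
Variable R : realType.
Implicit Types (u v w x y z : 'rV[R]_2) (S T X : {fset 'rV[R]_2}).

(* Rotate v towards v' until a second point enters the face of z. *)
Lemma face_pivot S v v' z : z \in face S v -> z \notin face S v' ->
  exists t x, [/\ 0 <= t, t < 1,
    z \in face S ((1 - t) *: v + t *: v'),
    x \in face S ((1 - t) *: v + t *: v') & dotp v' z < dotp v' x].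
Proof.
move=> zv zv'; have zS := face_sub zv.
(* [a x] is the lead of [z] over [x] in direction [v], and [c x] that of [x] over [z] in direction
   [v']. They draw level at parameter [a x / (a x + c x)]; the least such value is [t]. *)
pose a x := dotp v z - dotp v x; pose c x := dotp v' x - dotp v' z.
have a0 x : x \in S -> 0 <= a x by move=> /(face_le zv); rewrite subr_ge0.
pose X := [fset x in S | 0 < c x]%fset.
have [x0 x0X] : exists x0, x0 \in X.
  apply: contrapT => /forallNP h; move/negP: zv'; apply; apply/faceP; split => // y yS.
  by have := h y; rewrite in_fset_sep yS /= subr_gt0 => /negP; rewrite -leNgt.
have [x xX xmin] := fset_argmax (fun x => - (a x / (a x + c x))) x0X.
move: xX; rewrite in_fset_sep => /andP[xS cx].
have ac y : y \in S -> 0 < c y -> 0 < a y + c y.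
  by move=> yS cy; rewrite ltr_wpDl ?a0.
pose t := a x / (a x + c x).
have tE : t * (a x + c x) = a x by rewrite divfK // lt0r_neq0 // ac.
have t0 : 0 <= t by rewrite divr_ge0 ?a0 // ltW // ac.
have t1 : t < 1 by rewrite ltr_pdivrMr ?ac // mul1r ltrDl.
have main y : y \in S ->
    dotp ((1 - t) *: v + t *: v') y <= dotp ((1 - t) *: v + t *: v') z.
  move=> yS; rewrite !dotpDl !dotpZl.
  have ay := a0 y yS; rewrite -subr_ge0.
  rewrite (_ : _ - _ = (1 - t) * a y - t * c y); last by rewrite /a /c; ring.
  have [cy|cy] := leP (c y) 0; first by nra.
  have : y \in X by rewrite in_fset_sep yS.
  move=> /xmin; rewrite lerN2 ler_pdivlMr ?ac // -/t; lra.
have zw : z \in face S ((1 - t) *: v + t *: v') by apply/faceP.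
exists t, x; split => //; last by rewrite -subr_gt0.
apply: (face_eqP zw) => //; rewrite !dotpDl !dotpZl.
apply/eqP; rewrite -subr_eq0.
rewrite (_ : _ - _ = t * (a x + c x) - a x); last by rewrite /a /c; ring.
by rewrite tE subrr.
Qed.

(* u is the outer normal of the side through z of which z is not the last point
   in the direction [rt b u]; u is unique up to scaling. *)
Definition side_from b S u z := [/\ u != 0, z \in face S u &
  exists2 x, x \in face S u & dotp (rt b u) z < dotp (rt b u) x].

Lemma side_from_ex b S z : noncollinear S -> supported S -> z \in S ->
  exists u, side_from b S u z.
Proof.
move=> nc sup zS; have [v0 v00 zv0] := sup z zS.
(* If [z] also maximises [rt b v0], start there: the next quarter turn is [- v0], which [z] cannot
   maximise. *)
have [v [vn zv zv']] :
    exists v, [/\ v != 0, z \in face S v & z \notin face S (rt b v)].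
  have [h|h] := boolP (z \in face S (rt b v0)); last by exists v0.
  exists (rt b v0); split => //; first exact: rt_neq0.
  by rewrite rt_rt; apply: nc.
have [t [x [t0 t1 zw xw lt]]] := face_pivot zv zv'.
move: zw xw; set w := _ + _ => zw xw.
have xz : dotp (rt b w) z < dotp (rt b w) x.
  rewrite /w rtD !rtZ rt_rt !(dotpDl, dotpZl, dotpNl).
  have := face_le zv (face_sub xw); nra.
exists w; split => //; last by exists x.
apply/eqP => w0; move: xz; rewrite w0 -(scale0r 0) rtZ !dotpZl !mul0r.
by rewrite ltxx.
Qed.

(** [x] and [z] agree along [u], so only the component of [v] along [rt b u] tells them apart; as
    [z] maximises [v], it does not point from [z] to [x]. *)
Lemma face_rt_le b S u v z x : u != 0 -> z \in face S v -> z \in face S u ->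
  x \in face S u -> (dotp (rt b u) x - dotp (rt b u) z) * dotp (rt b u) v <= 0.
Proof.
move=> u0 zv zu xu; have := face_le zv (face_sub xu).
rewrite -(ler_pM2l (dotp_gt0 u0)) !(dotp_decomp b u) (face_eq zu xu); lra.
Qed.

Lemma face_parallel b S u v z : noncollinear S -> u != 0 -> v != 0 ->
  z \in face S u -> z \in face S v ->
  dotp (rt b u) v = 0 -> exists2 c, 0 < c & v = c *: u.
Proof.
move=> nc u0 v0 zu zv /(rt_parallel u0); set c := _ / _ => vc; exists c => //.
have [cneg|//|ez] := ltrgtP c 0; last by move: v0; rewrite vc ez scale0r eqxx.
have := nc u z u0 zu; rewrite -(@face_scale R S (- c)) ?oppr_gt0 //.
by rewrite scalerN scaleNr opprK -vc zv.
Qed.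

(** By [face_rt_le] both [dotp (rt b u) v] and [dotp (rt b v) u] are nonpositive; being negatives of
    each other, they vanish. *)
Lemma side_from_uniq b S u v z : noncollinear S ->
  side_from b S u z -> side_from b S v z -> exists2 c, 0 < c & v = c *: u.
Proof.
move=> nc [u0 zu [x xu xlt]] [v0 zv [y yv ylt]].
apply: (face_parallel (b := b) nc u0 v0 zu zv).
have := face_rt_le b u0 zv zu xu; have := face_rt_le b v0 zu zv yv.
rewrite (dotpC _ u) dotp_rtr; nra.
Qed.

(** At the last point of a side the next normal turns strictly in the sense [b]: [y] excludes a turn
    the other way, and without a turn [z] would not be last. *)
Lemma corner_turn b S u v y z : noncollinear S -> u != 0 ->
  z \in face S u -> (forall x, x \in face S u -> dotp (rt b u) x <= dotp (rt b u) z) ->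
  y \in face S u -> y != z -> side_from b S v z -> 0 < dotp (rt b u) v.
Proof.
move=> nc u0 zu zmax yu yz [v0 zv [x xv xlt]].
have ylt : dotp (rt b u) y < dotp (rt b u) z.
  rewrite lt_neqAle zmax // andbT; apply: contra yz => /eqP e.
  by apply/eqP; apply: face_rt_inj u0 yu zu e.
rewrite lt_neqAle; apply/andP; split; last first.
  have := face_rt_le b u0 zv zu yu; nra.
rewrite eq_sym; apply/negP => /eqP /(face_parallel nc u0 v0 zu zv)[c c0 vc].
move: xv xlt; rewrite vc face_scale // rtZ !dotpZl ltr_pM2l // => /zmax.
by rewrite leNgt => /negPf->.
Qed.

(** F(u + v) is the intersection of the two faces, which lie on transversal lines. *)
Lemma face_add1 b S u v z : u != 0 -> z \in face S u -> z \in face S v ->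
  dotp (rt b u) v != 0 -> u + v != 0 /\ face S (u + v) = [fset z]%fset.
Proof.
move=> u0 zu zv uv; split.
  apply: contra uv; rewrite addrC addr_eq0 => /eqP->.
  by rewrite dotpNr dotp_rt_self oppr0.
apply/fsetP => y; rewrite in_fset1; apply/idP/eqP => [yF|->]; last first.
  by rewrite -[u]scale1r -[v]scale1r face_cone ?ler01.
have [yu yv] := face_addE zu zv yF.
apply: (face_rt_inj (b := b) u0 yu zu); apply: (mulIf uv).
have e : dotp u u * dotp v y = dotp u u * dotp v z by rewrite (face_eq zv yv).
by move: e; rewrite !(dotp_decomp b u) (face_eq zu yu) => /addrI.
Qed.

(** * Exposed points as the vertices of the hull *)

Definition exposed S : {fset 'rV[R]_2} :=
  [fset z in S | `[< exists2 u, u != 0 & face S u = [fset z]%fset >]]%fset.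

Lemma exposedP S z :
  reflect (exists2 u, u != 0 & face S u = [fset z]%fset) (z \in exposed S).
Proof.
rewrite in_fset_sep; apply: (iffP andP) => [[_ /asboolP]//|h].
split; last exact/asboolP.
by case: h => u _ h; apply: (@face_sub _ _ u); rewrite h in_fset1.
Qed.

(** The end [r] is exposed by the sum of the normals of the two sides that meet there. *)
Lemma side_end_exposed b S u x y : noncollinear S -> supported S -> u != 0 ->
  x \in face S u -> y \in face S u -> x != y ->
  exists r, [/\ r \in exposed S, r \in face S u &
    forall z, z \in face S u -> dotp (rt b u) z <= dotp (rt b u) r].
Proof.
move=> nc sup u0 xu yu xy; have [r ru rmax] := face_end b xu.
exists r; split => //.
have [v vs] := side_from_ex b nc sup (face_sub ru).
have [w [wu wr]] : exists w, w \in face S u /\ w != r.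
  have [e|] := eqVneq x r; last by exists x.
  by exists y; rewrite eq_sym -e.
have pos := corner_turn nc u0 ru rmax wu wr vs.
have [v0 rv _] := vs.
have [h1 h2] := face_add1 u0 ru rv (lt0r_neq0 pos).
by apply/exposedP; exists (u + v).
Qed.

(** Every point lies on a side, between its two ends, and these are exposed. *)
Lemma exposed_hull S : noncollinear S -> supported S ->
  convex_hull [set` S] = convex_hull [set` exposed S].
Proof.
move=> nc sup; apply/seteqP; split; apply: convex_hull_min;
  try exact: convex_hull_convex; last first.
  move=> z /= zE; apply: sub_convex_hull; move: zE.
  by rewrite /= in_fset_sep => /andP[].
move=> z /= zS.
have [u [u0 zu [x xu lt]]] := side_from_ex false nc sup zS.
have zx : z != x by apply/eqP => e; move: lt; rewrite e ltxx.
have [r [rE ru rmax]] := side_end_exposed false nc sup u0 zu xu zx.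
have [l [lE lu lmax]] := side_end_exposed true nc sup u0 zu xu zx.
have lz : dotp (rt false u) l <= dotp (rt false u) z.
  by have := lmax z zu; rewrite -[true]/(~~ false) rt_negb !dotpNl lerN2.
have zr := lt_le_trans lt (rmax x xu).
have lr : 0 < dotp (rt false u) r - dotp (rt false u) l.
  by rewrite subr_gt0 (le_lt_trans lz).
pose t := (dotp (rt false u) z - dotp (rt false u) l) /
          (dotp (rt false u) r - dotp (rt false u) l).
have -> : z = t *: r + (1 - t) *: l.
  apply: (dotp_eq (b := false) u0); rewrite dotpDr !dotpZr.
    by rewrite (face_eq zu ru) (face_eq zu lu); ring.
  have h : t * (dotp (rt false u) r - dotp (rt false u) l) =
     dotp (rt false u) z - dotp (rt false u) l by rewrite divfK // lt0r_neq0.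
  lra.
apply: convex_hullP; try exact: sub_convex_hull.
  by rewrite divr_ge0 ?subr_ge0 // ltW // -subr_gt0.
by rewrite ler_pdivrMr // mul1r lerD2r ltW.
Qed.

(** * Opposite vertices and the parity of their number *)

Definition opposite S z y := exists u,
  [/\ u != 0, face S u = [fset z]%fset & face S (- u) = [fset y]%fset].

Lemma opposite_sym S z y : opposite S z y -> opposite S y z.
Proof. by move=> [u [h1 h2 h3]]; exists (- u); rewrite oppr_eq0 opprK. Qed.

(** If [u] and [u'] expose [z] while [y] and [y'] differ, pivoting from [- u] towards [- u'] meets a
    direction [w] with two points in F(w). But [- w] is in the cone of [u] and [u'] and selects only
    [z], against balance. *)
Lemma opposite_fun S z y y' : balanced S ->
  opposite S z y -> opposite S z y' -> y = y'.
Proof.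
move=> bal [u [u0 zu yu]] [u' [u0' zu' yu']]; apply/eqP/negPn/negP => yy'.
have yF : y \in face S (- u) by rewrite yu in_fset1.
have yF' : y \notin face S (- u') by rewrite yu' in_fset1.
have [t [x [t0 t1 yw xw lt]]] := face_pivot yF yF'.
move: yw xw; set w := _ + _ => yw xw.
have wE : - w = (1 - t) *: u + t *: u' by rewrite /w !scalerN opprD !opprK.
have t1' : 0 < 1 - t by rewrite subr_gt0.
have zF : z \in face S ((1 - t) *: u) by rewrite face_scale // zu in_fset1.
have zF' : z \in face S (t *: u').
  rewrite -[t *: u']add0r -(scale0r u'); apply: face_cone => //; by rewrite zu' in_fset1.
have e : face S (- w) = [fset z]%fset.
  apply/fsetP => p; rewrite in_fset1; apply/idP/eqP => [|->].
    rewrite wE => /(face_addE zF zF')[]; rewrite (@face_scale R S (1 - t)) // zu in_fset1.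
    by move=> /eqP.
  by rewrite wE; apply: face_cone; rewrite ?(ltW t1') // ?zu ?zu' ?in_fset1.
have : (1 < #|` face S w|)%N.
  rewrite (cardfsD1 x) xw ltnS cardfs_gt0; apply/fset0Pn; exists y.
  rewrite in_fsetD1 yw andbT; apply/eqP => yx; move: lt; by rewrite yx ltxx.
(* [balanced] does not cover [w = 0], but there F(w) and F(-w) coincide. *)
have [w0|w0] := eqVneq w 0; first by move: e; rewrite w0 oppr0 => ->; rewrite cardfs1.
by rewrite bal // e cardfs1.
Qed.

Lemma opposite_ex S z : balanced S -> z \in exposed S ->
  exists2 y, y \in exposed S & opposite S z y.
Proof.
move=> bal /exposedP[u u0 zu].
have /eqP/cardfs1P[y yu] : #|` face S (- u)| = 1%N by rewrite -bal // zu cardfs1.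
exists y; last by exists u.
by apply/exposedP; exists (- u); rewrite ?oppr_eq0.
Qed.

Lemma opposite_neq S z y : noncollinear S -> opposite S z y -> z != y.
Proof.
move=> nc [u [u0 zu yu]]; apply/eqP => e.
have : z \notin face S (- u) by apply: nc => //; rewrite zu in_fset1.
by rewrite yu e in_fset1 eqxx.
Qed.

Lemma even_matching (A : choiceType) (r : A -> A -> Prop) (V : {fset A}) :
  (forall a b, r a b -> r b a) -> (forall a b c, r a b -> r a c -> b = c) ->
  (forall a b, r a b -> a != b) ->
  (forall a, a \in V -> exists2 b, b \in V & r a b) ->
  exists s, #|` V| = (2 * s)%N.
Proof.
move=> rs rf ri; have [n] := ubnP #|` V|; elim: n V => // n IH V Vn rV.
have [->|/fset0Pn[a aV]] := eqVneq V fset0; first by exists 0%N; rewrite cardfs0.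
have [b bV ab] := rV a aV; have anb := ri _ _ ab.
have e : #|` V| = (#|` (V `\ a) `\ b|.+2)%fset.
  by rewrite (cardfsD1 a) aV (cardfsD1 b) in_fsetD1 bV eq_sym anb.
have [||s hs] := IH ((V `\ a) `\ b)%fset; first by move: Vn; rewrite e; lia.
  move=> c; rewrite !in_fsetD1 => /and3P[cb ca cV]; have [d dV cd] := rV c cV.
  exists d => //; rewrite !in_fsetD1 dV andbT; apply/andP; split.
    by apply: contra ca => /eqP e'; rewrite e' in cd; apply/eqP/(rf b); apply: rs.
  by apply: contra cb => /eqP e'; rewrite e' in cd; apply/eqP/(rf a) => //; apply: rs.
by exists s.+1; rewrite e hs; lia.
Qed.

Lemma exposed_even S : noncollinear S -> balanced S ->
  exists s, #|` exposed S| = (2 * s)%N.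
Proof.
move=> nc bal; apply: (@even_matching _ (opposite S)).
- exact: opposite_sym.
- by move=> a b c; apply: opposite_fun.
- by move=> a b; apply: opposite_neq.
- by move=> a; apply: opposite_ex.
Qed.

Lemma exposed_sub S : (exposed S `<=` S)%fset.
Proof. by apply/fsubsetP => x; rewrite in_fset_sep => /andP[]. Qed.

Lemma card_gt1P (A : choiceType) (V : {fset A}) :
  reflect (exists x y : A, [/\ x \in V, y \in V & x != y]) (1 < #|` V|)%N.
Proof.
apply: (iffP idP) => [h|[x [y [xV yV xy]]]].
  have /fset0Pn[x xV] : V != fset0 by rewrite -cardfs_gt0; lia.
  have /fset0Pn[y] : (V `\ x)%fset != fset0.
    by rewrite -cardfs_gt0; move: h; rewrite (cardfsD1 x) xV.
  by rewrite in_fsetD1 => /andP[yx yV]; exists x, y; rewrite eq_sym.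
rewrite (cardfsD1 x) xV ltnS cardfs_gt0; apply/fset0Pn; exists y.
by rewrite in_fsetD1 yV eq_sym xy.
Qed.

(** Take both ends of a side and one end of the opposite side, which has at least two points by
    balance. *)
Lemma exposed_ge3 S : noncollinear S -> supported S -> balanced S ->
  S != fset0 -> (3 <= #|` exposed S|)%N.
Proof.
move=> nc sup bal /fset0Pn[z zS].
have [u [u0 zu [x xu lt]]] := side_from_ex false nc sup zS.
have zx : z != x by apply/eqP => e; move: lt; rewrite e ltxx.
have [r [rE ru rmax]] := side_end_exposed false nc sup u0 zu xu zx.
have [l [lE lu lmax]] := side_end_exposed true nc sup u0 zu xu zx.
have rl : r != l.
  apply/eqP => e; move: (rmax x xu) (lmax z zu).
  rewrite -[true]/(~~ false) rt_negb !dotpNl lerN2 -e => h1 h2.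
  by have := le_trans h1 h2; rewrite leNgt lt.
have /card_gt1P[a [b [au bu ab]]] : (1 < #|` face S (- u)|)%N.
  by rewrite -bal //; apply/card_gt1P; exists z, x.
have u0' : - u != 0 by rewrite oppr_eq0.
have [q [qE qu _]] := side_end_exposed true nc sup u0' au bu ab.
have nq p : p \in face S u -> q != p.
  by move=> pu; apply/eqP => e; move: (nc u p u0 pu); rewrite -e qu.
rewrite (cardfsD1 r) rE (cardfsD1 l) in_fsetD1 lE eq_sym rl.
rewrite (cardfsD1 q) !in_fsetD1 qE !nq //=.
Qed.

End Sides.

(** * Boundary points are supported *)

Section Boundary.
Variable R : realType.
Implicit Types (u v w x y z : 'rV[R]_2) (S T X : {fset 'rV[R]_2}).

(** An open half-plane together with the one boundary point [x] is convex and contains [S]. *)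
Lemma face_hull_single S u x y : face S u = [fset x]%fset ->
  convex_hull [set` S] y -> dotp u y = dotp u x -> y = x.
Proof.
move=> hx hy; have xF : x \in face S u by rewrite hx in_fset1.
suff : [set y | y = x \/ dotp u y < dotp u x] y.
  by move=> /= [//|+ e]; rewrite e ltxx.
apply: convex_hull_min hy; last first.
  move=> p /= pS; have [e|e] := eqVneq (dotp u p) (dotp u x).
    by left; apply/eqP; rewrite -in_fset1 -hx; apply: face_eqP xF _ _.
  by right; rewrite lt_neqAle e (face_le xF).
apply/convex_setP => a b t /= ha hb t0 t1; rewrite dotpDr !dotpZr.
have [->|tn0] := eqVneq t 0.
  by rewrite scale0r add0r subr0 mul0r add0r mul1r scale1r.
have [->|tn1] := eqVneq t 1.
  by rewrite subrr scale0r addr0 mul0r addr0 mul1r scale1r.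
have {tn0}t0 : 0 < t by rewrite lt_neqAle eq_sym tn0.
have {tn1}t1 : t < 1 by rewrite lt_neqAle tn1.
case: ha hb => [->|ha] [->|hb].
- by left; rewrite -scalerDl addrC subrK scale1r.
- by right; nra.
- by right; nra.
- by right; nra.
Qed.

Lemma face_bd S v z : v != 0 -> z \in face S v -> bd (convex_hull [set` S]) z.
Proof.
move=> v0 zv; split.
  by apply: subset_closure; apply: sub_convex_hull; apply: face_sub zv.
rewrite /interior /= => /nbhs_ballP[e /= e0 sub].
have nv : 0 < `|v| by rewrite normr_gt0.
pose t := e / 2 / `|v|.
have t0 : 0 < t by rewrite !divr_gt0.
have : convex_hull [set` S] (z + t *: v).
  apply: sub; rewrite -ball_normE /ball_ /= opprD addrA subrr sub0r normrN normrZ.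
  by rewrite gtr0_norm // divfK ?lt0r_neq0 // ltr_pdivrMr // ltr_pMr // ltr1n.
move=> /(face_hull_le zv); rewrite dotpDr dotpZr gerDl leNgt mulr_gt0 //.
exact: dotp_gt0.
Qed.

(** By contradiction: if the hull has no point beyond [z] in direction [d], there is a support line
    through [z]. *)
Lemma interior_ray S d z : z \in S -> (forall v, v != 0 -> z \notin face S v) ->
  d != 0 -> exists2 e, 0 < e & convex_hull [set` S] (z + e *: d).
Proof.
move=> zS hz d0; apply: contrapT => H.
have dd := dotp_gt0 d0.
have key p : convex_hull [set` S] p ->
    dotp (rt false d) p = dotp (rt false d) z -> dotp d p <= dotp d z.
  move=> hp e; rewrite leNgt; apply/negP => lt; apply: H.
  exists ((dotp d p - dotp d z) / dotp d d).
    by rewrite divr_gt0 // subr_gt0.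
  rewrite (_ : z + _ = p) //.
  apply: (dotp_eq (b := false) d0); rewrite dotpDr dotpZr.
    by rewrite divfK ?lt0r_neq0 // addrC subrK.
  by rewrite dotp_rt_self mulr0 addr0 e.
(* In the coordinates (a, c) along d and its normal, no chord meets the ray;
   so the largest slope a / c above the ray is the slope of a supporting line. *)
pose a x := dotp d x - dotp d z.
pose c x := dotp (rt false d) x - dotp (rt false d) z.
have key2 x y : x \in S -> y \in S -> 0 < c x -> c y < 0 ->
    a y * c x - a x * c y <= 0.
  (* [t] is the weight at which the chord from [x] to [y] crosses the line through [z] in direction
     [d]. *)
  move=> xS yS cx cy; pose t := - c y / (c x - c y).
  have D0 : 0 < c x - c y by lra.
  have tE : t * (c x - c y) = - c y by rewrite divfK // lt0r_neq0.
  have t0 : 0 <= t by rewrite divr_ge0 //; lra.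
  have t1 : t <= 1 by rewrite ler_pdivrMr //; lra.
  have e : dotp (rt false d) (t *: x + (1 - t) *: y) = dotp (rt false d) z.
    by rewrite !dotpDr !dotpZr; move: tE; rewrite /c; lra.
  have := key _ (convex_hullP (sub_convex_hull xS) (sub_convex_hull yS) t0 t1) e.
  rewrite !dotpDr !dotpZr => h; have {}h : t * a x + (1 - t) * a y <= 0 by rewrite /a; lra.
  have : (t * a x + (1 - t) * a y) * (c x - c y) <= 0 by rewrite pmulr_lle0.
  rewrite (_ : _ * _ = t * (c x - c y) * a x +
    ((c x - c y) - t * (c x - c y)) * a y); last by ring.
  by rewrite tE; lra.
pose X := [fset x in S | 0 < c x]%fset.
have [x0 x0X] : exists x0, x0 \in X.
  apply: contrapT => /forallNP h.
  move/negP: (hz (rt false d) (rt_neq0 _ d0)); apply; apply/faceP; split => // y yS.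
  by have := h y; rewrite in_fset_sep yS /= subr_gt0 => /negP; rewrite -leNgt.
have [x xX xmax] := fset_argmax (fun x => a x / c x) x0X.
move: xX; rewrite in_fset_sep => /andP[xS cx].
pose rho := a x / c x; have rE : rho * c x = a x by rewrite divfK // lt0r_neq0.
have v0 : d - rho *: rt false d != 0.
  apply/eqP => e; have := dotp0l d; rewrite -e dotpDl dotpNl dotpZl dotp_rt_self.
  by rewrite mulr0 subr0 => e'; move: dd; rewrite e' ltxx.
move/negP: (hz _ v0); apply; apply/faceP; split => // y yS.
suff : a y - rho * c y <= 0.
  by rewrite !dotpDl !dotpNl !dotpZl /a /c; lra.
(* Below the ray the chords give the bound, above it the maximality of [rho], and on its line
   [key]. *)
have [cy|cy|cy] := ltrgtP (c y) 0.
- have := key2 x y xS yS cx cy; rewrite -rE.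
  rewrite (_ : _ - _ = (a y - rho * c y) * c x); last by ring.
  by rewrite pmulr_lle0.
- have : y \in X by rewrite in_fset_sep yS.
  move=> /xmax; rewrite -/rho ler_pdivrMr //; lra.
- rewrite cy mulr0 subr0 subr_le0; apply: key; first exact: sub_convex_hull.
  by apply/eqP; rewrite -subr_eq0; apply/eqP.
Qed.

Lemma interior_segment S d z : z \in S ->
  (forall v, v != 0 -> z \notin face S v) -> d != 0 ->
  exists2 e, 0 < e &
    forall t, `|t| < e -> convex_hull [set` S] (z + t *: d).
Proof.
move=> zS hz d0; have zP : convex_hull [set` S] z by exact: sub_convex_hull.
have seg d' e t : 0 < e -> convex_hull [set` S] (z + e *: d') ->
    0 <= t -> t <= e -> convex_hull [set` S] (z + t *: d').
  move=> e0 h t0 te.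
  have -> : z + t *: d' = (t / e) *: (z + e *: d') + (1 - t / e) *: z.
    rewrite scalerDr scalerA divfK ?lt0r_neq0 // scalerBl scale1r.
    by rewrite addrAC (addrC (_ *: z)) subrK.
  apply: convex_hullP => //; first by rewrite divr_ge0 // ltW.
  by rewrite ler_pdivrMr // mul1r.
have [e1 e10 h1] := interior_ray zS hz d0.
have d0' : - d != 0 by rewrite oppr_eq0.
have [e2 e20 h2] := interior_ray zS hz d0'.
exists (Num.min e1 e2); first by rewrite lt_min e10.
move=> t; rewrite lt_min => /andP[t1 t2].
have [t0|t0] := leP 0 t; first by apply: (seg _ _ _ e10 h1 t0); rewrite -(ger0_norm t0) ltW.
rewrite -[t *: d]opprK -scalerN -scaleNr.
by apply: seg e20 h2 _ _; rewrite ?oppr_ge0 ?ltW // -(ltr0_norm t0).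
Qed.

(** A point near [z] is the midpoint of two points on the axis-parallel segments through [z], with
    doubled displacements; hence the factor 1/2 in the radius. *)
Lemma bd_face S z : z \in S -> bd (convex_hull [set` S]) z ->
  exists2 v, v != 0 & z \in face S v.
Proof.
move=> zS [_ zI]; apply: contrapT => H; apply: zI.
have hz v : v != 0 -> z \notin face S v.
  by move=> v0; apply/negP => h; apply: H; exists v.
have dn (j : 'I_2) : (delta_mx 0 j : 'rV[R]_2) != 0.
  apply/eqP => /rowP /(_ j); rewrite !mxE !eqxx => /eqP; by rewrite oner_eq0.
have [e1 e10 h1] := interior_segment zS hz (dn 0).
have [e2 e20 h2] := interior_segment zS hz (dn 1).
apply/nbhs_ballP; exists (Num.min e1 e2 / 2) => /=.
  by rewrite divr_gt0 // lt_min e10.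
move=> y zy.
have hb (j : 'I_2) : `|2 * (y 0 j - z 0 j)| < Num.min e1 e2.
  have := (proj2 zy) 0 j; rewrite -ball_normE /ball_ /= distrC => h.
  by rewrite normrM ger0_norm // mulrC -ltr_pdivlMr.
have := hb 0; rewrite lt_min => /andP[/h1 p1 _].
have := hb 1; rewrite lt_min => /andP[_ /h2 p2].
have -> : y = 2^-1 *: (z + (2 * (y 0 0 - z 0 0)) *: delta_mx 0 0) +
     (1 - 2^-1) *: (z + (2 * (y 0 1 - z 0 1)) *: delta_mx 0 1).
  by apply: row2P; rewrite !mxE /=; field.
apply: convex_hullP => //; lra.
Qed.

End Boundary.

(** * The converse *)

Section FiberMatching.
Implicit Types A B : choiceType.

Lemma card_fibers A B (S : {fset A}) (C : {fset B}) (h : A -> B) :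
  #|` [fset y in S | h y \in C]%fset| =
  (\sum_(c <- C) #|` [fset y in S | h y == c]%fset|)%N.
Proof.
have sep (P : pred A) : #|` [fset y in S | P y]%fset| = (\sum_(y <- S | P y) 1)%N.
  rewrite card_fset_sum1 -[RHS]big_filter; apply: perm_big; apply: uniq_perm => //.
    by rewrite filter_uniq ?fset_uniq.
  by move=> x; rewrite mem_filter in_fset_sep andbC.
rewrite sep (eq_bigr _ (fun c _ => sep (fun y => h y == c))).
rewrite (exchange_big_dep xpredT) //= big_mkcond; apply: eq_bigr => y _.
rewrite [RHS]big_mkcond /=; case: ifP => hy.
  rewrite (big_fsetD1 (h y)) //= eqxx big1_fset ?addn0 // => c.
  by rewrite in_fsetD1 eq_sym => /andP[/negPf-> _].
rewrite big1_fset // => c cC _; case: eqP => // e; by rewrite e cC in hy.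
Qed.

(** [U] gathers the fibres that meet [T], and [W] the opposite ones. They are disjoint and equally
    large, so 2 card T <= 2 card U <= card S <= 2 card T. Equality gives [U = T], and [U] and [W]
    cover [S]. *)
Lemma fiber_matching A B (S T : {fset A}) (g : A -> B) (opp : B -> B) :
  involutive opp -> (T `<=` S)%fset ->
  (forall z, z \in S -> #|` [fset y in S | g y == opp (g z)]%fset| =
                        #|` [fset y in S | g y == g z]%fset|) ->
  (forall x y, x \in T -> y \in T -> g x <> opp (g y)) ->
  (#|` S| <= 2 * #|` T|)%N ->
  forall z y, z \in S -> y \in S -> g y = opp (g z) -> z \in T \/ y \in T.
Proof.
move=> oppK TS hfib hT hcard.
pose C := (g @` T)%fset.
pose U := [fset y in S | g y \in C]%fset.
pose W := [fset y in S | opp (g y) \in C]%fset.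
have TU : (T `<=` U)%fset.
  apply/fsubsetP => x xT; rewrite in_fset_sep (fsubsetP TS) //=.
  by apply/imfsetP; exists x.
have UW : #|` U| = #|` W|.
  rewrite (card_fibers S C g) (card_fibers S C (opp \o g)).
  apply: eq_big_seq => _ /imfsetP[/= t tT ->].
  rewrite -(hfib t); last exact: (fsubsetP TS).
  congr #|` _|; apply/fsetP => y; rewrite !in_fset_sep; congr (_ && _) => /=.
  by rewrite -(inj_eq (inv_inj oppK)) oppK.
have UWd : (U `&` W = fset0)%fset.
  apply/fsetP => y; rewrite in_fsetI !in_fset_sep in_fset0; apply/negP.
  move=> /andP[/andP[_ /imfsetP[/= t tT e]] /andP[_ /imfsetP[/= t' tT' e']]].
  by apply: (hT t' t) => //; rewrite -e -e'.
have UWS : (U `|` W `<=` S)%fset.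
  by apply/fsubsetP => y; rewrite in_fsetU !in_fset_sep => /orP[] /andP[].
have c1 := fsubset_leq_card UWS; have c2 := fsubset_leq_card TU.
have c3 := cardfsUI U W; rewrite UWd cardfs0 in c3.
have UT : U = T.
  by apply/eqP; rewrite eq_sym eqEfcard TU /=; lia.
have UWE : (U `|` W)%fset = S.
  by apply/eqP; rewrite eqEfcard UWS /=; lia.
move=> z y; rewrite -{1}UWE in_fsetU UT => /orP[zT|]; first by left.
rewrite in_fset_sep => /andP[zS zC] yS gy; right.
by rewrite -UT in_fset_sep yS gy.
Qed.

End FiberMatching.

Section Converse.
Variable R : realType.
Implicit Types (u v w x y z : 'rV[R]_2) (S T X : {fset 'rV[R]_2}).

Lemma side_fromZ b S c u z : 0 < c -> side_from b S u z -> side_from b S (c *: u) z.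
Proof.
move=> c0 [u0 zu [x xu lt]]; split; rewrite ?face_scale //.
  by rewrite scaler_eq0 negb_or u0 lt0r_neq0.
by exists x; rewrite ?face_scale // rtZ !dotpZl ltr_pM2l.
Qed.

Lemma side_from_exists b S u : u != 0 -> (1 < #|` face S u|)%N ->
  exists z, side_from b S u z.
Proof.
move=> u0 /card_gt1P[x [y [xu yu xy]]].
have [lt|lt|e] := ltrgtP (dotp (rt b u) x) (dotp (rt b u) y).
- by exists x; split => //; exists y.
- by exists y; split => //; exists x.
- by case/eqP: xy; apply: face_rt_inj u0 xu yu e.
Qed.

Lemma side_from_gt1 b S u z : side_from b S u z -> (1 < #|` face S u|)%N.
Proof.
move=> [u0 zu [x xu lt]]; apply/card_gt1P; exists z, x; split => //.
by apply/eqP => e; move: lt; rewrite e ltxx.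
Qed.

Lemma side_from_card b S u : u != 0 -> (1 < #|` face S u|)%N ->
  #|` [fset y in S | `[< side_from b S u y >]]%fset| = #|` face S u|.-1.
Proof.
move=> u0 h; have /card_gt1P[x [_ [xu _ _]]] := h.
have [r ru rmax] := face_end b xu.
rewrite (cardfsD1 r (face S u)) ru /=; congr #|` _|; apply/fsetP => y.
rewrite in_fset_sep in_fsetD1; apply/andP/andP => [[yS /asboolP[_ yu [z zu lt]]]|].
  split=> //; apply/eqP => yr; move: (rmax z zu); rewrite -yr leNgt lt //.
move=> [yr yu]; split; first exact: face_sub yu.
apply/asboolP; split => //; exists r => //; rewrite lt_neqAle rmax // andbT.
by apply: contra yr => /eqP /(face_rt_inj u0 yu ru) ->.
Qed.

Lemma indep_opposite_faces S T u x y : noncollinear S -> indep S T ->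
  u != 0 -> x \in T -> y \in T -> x \in face S u -> y \in face S (- u) -> False.
Proof.
move=> nc iT u0 xT yT xu yu; apply: (iT x y xT yT); exists u; split => //.
rewrite lt_neqAle (face_le xu (face_sub yu)) andbT; apply/eqP => e.
have := nc (- u) y; rewrite oppr_eq0 opprK => /(_ u0 yu) /negP; apply.
exact: face_eqP xu (face_sub yu) e.
Qed.

(** This is [fiber_matching] for the map from a point to the normal of the side on which it is not
    last. The fibres are sides without their last point; balance makes opposite ones equally
    large. *)
Lemma half_side b S T : noncollinear S -> supported S -> balanced S ->
  (T `<=` S)%fset -> indep S T -> (#|` S| <= 2 * #|` T|)%N ->
  forall u z y, side_from b S u z -> side_from b S (- u) y ->
  z \in T \/ y \in T.
Proof.
move=> nc sup bal TS iT hcard.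
(* Normalising the outer normals makes them unique, so that the opposite side
   corresponds to negation. *)
have /choice[g gP] : forall z, exists u, z \in S -> side_from b S u z /\ `|u| = 1.
  move=> z; have [zS|] := boolP (z \in S); last by exists 0.
  have [u us] := side_from_ex b nc sup zS; have [u0 _ _] := us.
  have nu : 0 < `|u| by rewrite normr_gt0.
  exists (`|u|^-1 *: u) => _; split; first by apply: side_fromZ => //; rewrite invr_gt0.
  by rewrite normrZ normfV normr_id mulVf // lt0r_neq0.
have gU u z : z \in S -> side_from b S u z -> `|u| = 1 -> g z = u.
  move=> zS us u1; have [gs g1] := gP z zS.
  have [c c0 e] := side_from_uniq nc us gs; rewrite e.
  move: g1; rewrite e normrZ u1 mulr1 gtr0_norm // => ->.
  by rewrite scale1r.
have fibE u : `|u| = 1 ->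
    [fset y in S | g y == u]%fset = [fset y in S | `[< side_from b S u y >]]%fset.
  move=> u1; apply/fsetP => y; rewrite !in_fset_sep; apply: andb_id2l => yS.
  by apply/eqP/asboolP => [<-|h]; [case: (gP y yS)|apply: gU].
have main := @fiber_matching _ _ S T g -%R (@opprK _) TS _ _ hcard.
have {}main : forall z y, z \in S -> y \in S -> g y = - g z -> z \in T \/ y \in T.
  apply: main.
    move=> z zS; have [gs g1] := gP z zS; have [g0 _ _] := gs.
    have gt1 := side_from_gt1 gs.
    rewrite !fibE ?normrN // !side_from_card ?oppr_eq0 // -?bal //.
  move=> x y xT yT gxy.
  have [[g0 yg _] _] := gP y (fsubsetP TS y yT).
  have [[_ xg _] _] := gP x (fsubsetP TS x xT); rewrite gxy in xg.
  exact: indep_opposite_faces nc iT g0 yT xT yg xg.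
move=> u z y uz uy; have [u0 zu _] := uz; have [_ yu _] := uy.
have [zS yS] := (face_sub zu, face_sub yu).
have nu : 0 < `|u| by rewrite normr_gt0.
have nv : 0 < `|u|^-1 by rewrite invr_gt0.
have n1 : `| `|u|^-1 *: u| = 1.
  by rewrite normrZ normfV normr_id mulVf // lt0r_neq0.
apply: main => //; rewrite (gU (`|u|^-1 *: u) z) ?(gU (- (`|u|^-1 *: u)) y) //.
- by rewrite -scalerN; apply: side_fromZ.
- by rewrite normrN.
- exact: side_fromZ.
Qed.

(** In one of the two senses [b], [x] is not last on its side. Then [half_side] puts [x] or a point
    of the opposite side in [T], and [t] excludes the latter. *)
Lemma full_side S T u t : noncollinear S -> supported S -> balanced S ->
  (T `<=` S)%fset -> indep S T -> (#|` S| <= 2 * #|` T|)%N ->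
  u != 0 -> (1 < #|` face S u|)%N -> t \in T -> t \in face S u ->
  forall x, x \in face S u -> x \in T.
Proof.
move=> nc sup bal TS iT hcard u0 gt1 tT tu x xu.
have [y [yu yx]] : exists y, y \in face S u /\ y != x.
  have /card_gt1P[a [c [au cu ac]]] := gt1.
  have [e|] := eqVneq a x; last by exists a.
  by exists c; rewrite eq_sym -e.
have [b lt] : exists b, dotp (rt b u) x < dotp (rt b u) y.
  have [lt|lt|e] := ltrgtP (dotp (rt false u) x) (dotp (rt false u) y).
  - by exists false.
  - by exists true; rewrite -[true]/(~~ false) rt_negb !dotpNl ltrN2.
  - by case/eqP: yx; apply: esym; apply: face_rt_inj u0 xu yu e.
have u0' : - u != 0 by rewrite oppr_eq0.
have [z zs] : exists z, side_from b S (- u) z.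
  by apply: side_from_exists; rewrite // -bal.
have xs : side_from b S u x by split => //; exists y.
have [//|zT] := half_side nc sup bal TS iT hcard xs zs.
have [_ zu _] := zs.
by case: (indep_opposite_faces nc iT u0 tT zT tu zu).
Qed.

Lemma dotp_rt_rt b u v : dotp (rt b u) (rt b v) = dotp u v.
Proof. by rewrite dotp_rtr rt_rt dotpNl opprK. Qed.

(** One step of the walk: within [T] the normals cannot turn as far as [- u], since a point of [T]
    in F(-u) would be antipodal to [t]. *)
Lemma next_side_pos b S T u v w z t : noncollinear S -> indep S T ->
  u != 0 -> t \in T -> t \in face S u -> z \in T ->
  0 < dotp (rt b u) v -> z \in face S v -> side_from b S w z ->
  0 < dotp (rt b u) w.
Proof.
move=> nc iT u0 tT tu zT pos zv [w0 zw [x xw lt]].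
rewrite ltNge; apply/negP => neg.
have v0 : v != 0.
  by apply/eqP => v0; move: pos; rewrite v0 dotpC dotp0l ltxx.
set s := dotp (rt b u) v in pos; set m := dotp (rt b u) w in neg.
(* If w were on the other side, -u would be in the cone of v and w, and z would
   lie in F(-u). *)
pose q := s *: w + (- m) *: v.
have zq : z \in face S q by apply: face_cone; rewrite ?oppr_ge0 // ltW.
have wv : dotp (rt b w) v <= 0.
  have := face_rt_le b w0 zv zw xw; nra.
have uq : dotp u q = dotp u u * dotp (rt b w) v.
  have := dotp_decomp b u (rt b w) v.
  rewrite dotp_rt_rt dotp_rtr -/s -/m => ->.
  by rewrite /q dotpDr !dotpZr; ring.
have uu := dotp_gt0 u0.
have /(rt_parallel u0) : dotp (rt b u) q = 0.
  by rewrite /q dotpDr !dotpZr -/s -/m; ring.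
rewrite uq mulrAC divff ?lt0r_neq0 // mul1r; set c := dotp (rt b w) v in wv *.
move=> qc; have [c0|c0] := eqVneq c 0; last first.
  have {}c0 : 0 < - c by rewrite oppr_gt0 lt_neqAle c0.
  apply: (indep_opposite_faces nc iT u0 tT zT tu).
  by rewrite -(face_scale _ _ c0) scalerN scaleNr opprK -qc.
(* Here [q = 0]; then [w] is a positive multiple of [- v], and [z] would maximise both [v] and
   [- v]. *)
have wE : w = (- m / s) *: (- v).
  have e : s *: w = m *: v.
    apply/eqP; rewrite -subr_eq0 -scaleNr -/q; by rewrite qc c0 scale0r.
  rewrite scalerN mulNr scaleNr opprK mulrC -scalerA -e scalerA mulVf ?scale1r //.
  exact: lt0r_neq0.
have m0 : 0 < - m.
  rewrite oppr_gt0 lt_neqAle neg andbT; apply: contra w0 => /eqP m0.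
  by rewrite wE m0 oppr0 mul0r scale0r.
move: zw; rewrite wE face_scale ?divr_gt0 //.
by apply/negP; apply: nc.
Qed.

Lemma balanced_indep S T : noncollinear S -> supported S -> balanced S ->
  S != fset0 -> (T `<=` S)%fset -> indep S T -> (2 * #|` T| < #|` S|)%N.
Proof.
move=> nc sup bal S0 TS iT; rewrite ltnNge; apply/negP => hcard.
have [t tT] : exists t, t \in T.
  by apply/fset0Pn; rewrite -cardfs_gt0; move: S0; rewrite -cardfs_gt0; lia.
have [u us] := side_from_ex false nc sup (fsubsetP TS t tT).
have [u0 tu [y yu lt]] := us; have gt1 := side_from_gt1 us.
have full := full_side nc sup bal TS iT hcard.
have [r ru rmax] := face_end false tu.
have rT := full u t u0 gt1 tT tu r ru.
have tr : t != r by apply/eqP => e; move: (rmax y yu); rewrite -e leNgt lt.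
have [v vs] := side_from_ex false nc sup (face_sub ru).
have vpos := corner_turn nc u0 ru rmax tu tr vs.
(* Walk along T from the side with normal u; the lowest point reached is not the
   last point of its side, a contradiction. *)
pose Z := [fset z in T |
  `[< exists v, 0 < dotp (rt false u) v /\ z \in face S v >]]%fset.
have rZ : r \in Z.
  by rewrite in_fset_sep rT; apply/asboolP; exists v; case: vs.
have [z zZ zmin] := fset_argmax (fun z => - dotp u z) rZ.
move: zZ; rewrite in_fset_sep => /andP[zT /asboolP[v' [v'pos zv']]].
have [w ws] := side_from_ex false nc sup (fsubsetP TS z zT).
have wpos := next_side_pos nc iT u0 tT tu zT v'pos zv' ws.
have [w0 zw [x xw ltx]] := ws.
have xT := full w z w0 (side_from_gt1 ws) zT zw x xw.
have xZ : x \in Z by rewrite in_fset_sep xT; apply/asboolP; exists w.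
(* [x] and [z] differ only along [rt false w], where [u] has a negative component; so [x] is
   strictly lower than [z]. *)
have := zmin x xZ; rewrite lerN2 -(ler_pM2l (dotp_gt0 w0)).
rewrite !(dotp_decomp false w) (face_eq zw xw) lerD2l.
rewrite leNgt => /negP; apply.
by rewrite ltr_nM2r // dotpC dotp_rtr oppr_lt0.
Qed.

End Converse.

(** * Polygons and the extremal example *)

Section Polygon.
Variable R : realType.
Implicit Types (u v w x y z : 'rV[R]_2) (S T X : {fset 'rV[R]_2}).

Definition edge S u x : set 'rV[R]_2 :=
  convex_hull [set` S] `&` level_set u (dotp u x).

Lemma num_points_edge S u x : x \in face S u ->
  num_points_on S (edge S u x) = #|` face S u|.
Proof.
move=> xu; congr #|` _|; apply/fsetP => y; rewrite in_fset_sep.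
apply/andP/idP => [[yS /set_mem[_ e]]|yu]; first exact: face_eqP xu yS e.
split; first exact: face_sub yu.
apply/mem_set; split; first by apply: sub_convex_hull; apply: face_sub yu.
exact: face_eq xu yu.
Qed.

Lemma edge_side S u x : u != 0 -> x \in face S u -> (1 < #|` face S u|)%N ->
  side (convex_hull [set` S]) (edge S u x).
Proof.
move=> u0 xu /card_gt1P[a [c [au cu ac]]].
exists (level_set u (dotp u x)); split => //; first by apply/supportingP; exists u, x.
exists a, c; split; last exact/eqP.
  by split; [apply: sub_convex_hull; apply: face_sub au|apply: face_eq xu au].
by split; [apply: sub_convex_hull; apply: face_sub cu|apply: face_eq xu cu].
Qed.

(** A face with one point meets the hull's support line in that point alone, so a side needs two
    points of [S]. *)
Lemma side_edge S F : side (convex_hull [set` S]) F ->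
  exists u x, [/\ u != 0, x \in face S u, F = edge S u x
    & (1 < #|` face S u|)%N].
Proof.
move=> [H [/supportingP[u [x [u0 xu ->]]] -> [a [c [[aP ae] [cP ce] ac]]]]].
exists u, x; split => //; rewrite ltnNge; apply/negP => le1.
have /eqP/cardfs1P[r fr] : #|` face S u| = 1%N.
  by move: le1; rewrite (cardfsD1 x) xu; lia.
have xr : x = r by apply/eqP; rewrite -in_fset1 -fr.
by apply: ac; rewrite xr in ae ce;
  rewrite (face_hull_single fr aP ae) (face_hull_single fr cP ce).
Qed.

Lemma opposite_edges S u x y : noncollinear S -> u != 0 ->
  x \in face S u -> y \in face S (- u) ->
  edge S (- u) y <> edge S u x /\ parallel_sides (edge S u x) (edge S (- u) y).
Proof.
move=> nc u0 xu yu; split.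
  move=> e; have [_ h] : edge S (- u) y x.
    by rewrite e; split => //; apply: sub_convex_hull; apply: face_sub xu.
  by move/negP: (nc u x u0 xu); apply; apply: face_eqP yu (face_sub xu) h.
exists (level_set u (dotp u x)), (level_set u (dotp u y)); split.
- by move=> z [].
- by move=> z [_]; rewrite /level_set /= !dotpNl => /oppr_inj.
- by exists u, (dotp u x), (dotp u y).
Qed.

Lemma structure_polygon S (k : nat) : (0 < k)%N -> #|` S| = (2 * k)%N ->
  noncollinear S -> supported S -> balanced S ->
  exists s : nat,
    [/\ (s <= k)%N, convex_gon (2 * s)%N (convex_hull [set` S]),
        [set` S] `<=` bd (convex_hull [set` S]), #|` S| = (2 * k)%N
      & forall F : set 'rV[R]_2, side (convex_hull [set` S]) F ->
          exists F' : set 'rV[R]_2,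
            [/\ side (convex_hull [set` S]) F', F' <> F, parallel_sides F F'
              & num_points_on S F = num_points_on S F']].
Proof.
move=> k0 Sk nc sup bal.
have [s Es] := exposed_even nc bal; exists s.
have S0 : S != fset0 by rewrite -cardfs_gt0; lia.
have Ege := exposed_ge3 nc sup bal S0.
have Ele := fsubset_leq_card (exposed_sub S).
split => //; first by lia.
- split; first by rewrite -Es.
  exists (exposed S); split => //; first exact: exposed_hull.
  move=> v /exposedP[u u0 fv] /=.
  have vu : v \in face S u by rewrite fv in_fset1.
  (* The other vertices lie in the open half-plane below [v], hence so does their hull. *)
  move=> /(convex_hull_lt (u := u) (c := dotp u v)) /= h.
  suff : dotp u v < dotp u v by rewrite ltxx.
  apply: h => y [/= yE /eqP yv]; have yS := fsubsetP (exposed_sub S) y yE.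
  rewrite lt_neqAle (face_le vu yS) andbT; apply: contra yv => /eqP e.
  by rewrite -in_fset1 -fv; apply: face_eqP vu yS e.
- by move=> z /= /sup[v v0 zv]; apply: face_bd v0 zv.
- move=> F /side_edge[u [x [u0 xu -> gt1]]].
  have [y yu] := face_ex (- u) (face_sub xu).
  have u0' : - u != 0 by rewrite oppr_eq0.
  have [h1 h2] := opposite_edges nc u0 xu yu.
  exists (edge S (- u) y); split => //; first by apply: edge_side; rewrite -?bal.
  by rewrite !num_points_edge // bal.
Qed.

(** For points on a line the hull is its own only possible side, so no second side can be parallel
    to it. *)
Lemma side_of_collinear S u x F' : u != 0 ->
  x \in face S u -> x \in face S (- u) ->
  side (convex_hull [set` S]) F' -> F' = convex_hull [set` S].
Proof.
move=> u0 xu xu' [H [/supportingP[v [y [v0 yv ->]]] -> [a [c [[aP ae] [cP ce] ac]]]]].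
have hu z : convex_hull [set` S] z -> dotp u z = dotp u x.
  move=> zP; have := face_hull_le xu zP; have := face_hull_le xu' zP.
  by rewrite !dotpNl; lra.
have [e ve] : exists e, v = e *: u.
  apply: (two_points_parallel u0 (x := a) (y := c)); first exact/eqP.
    by rewrite !hu.
  by rewrite ae ce.
apply/seteqP; split => z; first by case.
by move=> zP; split => //; rewrite -ae /level_set /= ve !dotpZl !hu.
Qed.

Lemma face_opposite_of_parallel S u v x y : u != 0 -> v != 0 -> x \in face S u ->
  y \in face S v -> edge S u x <> edge S v y ->
  (exists e, v = e *: u) -> face S v = face S (- u).
Proof.
move=> u0 v0 xu yv ne [e ve].
have [e0|e0|e0] := ltrgtP e 0.
- by rewrite ve -[in RHS](@face_scale R S (- e)) ?oppr_gt0 // scalerN scaleNr opprK.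
- case: ne; move: yv; rewrite ve face_scale // => yu.
  by rewrite /edge dotpZl level_setZ ?lt0r_neq0 // (face_eq xu yu).
- by move: v0; rewrite ve e0 scale0r eqxx.
Qed.

(** A face with at least two points gives a side, whose parallel partner must be the opposite face;
    two opposite one-point faces balance trivially. *)
Lemma polygon_structure S : (1 < #|` S|)%N ->
  [set` S] `<=` bd (convex_hull [set` S]) ->
  (forall F : set 'rV[R]_2, side (convex_hull [set` S]) F ->
    exists F' : set 'rV[R]_2,
      [/\ side (convex_hull [set` S]) F', F' <> F, parallel_sides F F'
        & num_points_on S F = num_points_on S F']) ->
  [/\ noncollinear S, supported S & balanced S].
Proof.
move=> S2 Sbd hF.
have sup : supported S.
  by move=> z zS; apply: bd_face => //; apply: Sbd.
have nc : noncollinear S.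
  move=> u x u0 xu; apply/negP => xu'.
  have fS : face S u = S.
    apply/fsetP => y; apply/idP/idP => [/face_sub//|yS].
    apply: (face_eqP xu yS).
    have := face_le xu yS; have := face_le xu' yS; rewrite !dotpNl; lra.
  have sF : side (convex_hull [set` S]) (edge S u x) by apply: edge_side => //; rewrite fS.
  have [F' [sF' ne _ _]] := hF _ sF; apply: ne.
  by rewrite (side_of_collinear u0 xu xu' sF')
             (side_of_collinear u0 xu xu' sF).
split => //.
have bal1 u : u != 0 -> (1 < #|` face S u|)%N ->
    #|` face S u| = #|` face S (- u)|.
  move=> u0 gt1; have /card_gt1P[a [c [au cu /eqP ac]]] := gt1.
  have sF := edge_side u0 au gt1.
  have [F' [sF' ne [H1 [H2 [s1 s2 [w [c1 [c2 [w0 e1 e2]]]]]]] hn]] := hF _ sF.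
  have [v [y [v0 yv F'E gt1']]] := side_edge sF'.
  have par q p F H d : q != 0 -> p \in face S q -> (1 < #|` face S q|)%N ->
      F = edge S q p -> F `<=` H -> H = level_set w d -> exists e, w = e *: q.
    move=> q0 pq /card_gt1P[a' [b' [aq bq ab]]] -> sH eH.
    have inH r : r \in face S q -> dotp w r = d.
      move=> rq; have : H r.
        apply: sH; split; last exact: face_eq pq rq.
        by apply: sub_convex_hull; apply: face_sub rq.
      by rewrite eH.
    apply: (two_points_parallel q0 ab); first exact: face_eq bq aq.
    by rewrite !inH.
  have pu := par _ _ _ _ _ u0 au gt1 erefl s1 e1.
  have pv := par _ _ _ _ _ v0 yv gt1' F'E s2 e2.
  have vu := parallel_trans v0 w0 pu pv.
  rewrite -(face_opposite_of_parallel u0 v0 au yv _ vu); last by rewrite -F'E; apply: nesym.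
  by rewrite -(num_points_edge au) -(num_points_edge yv) -F'E.
move=> u u0; have [gt1|le1] := ltnP 1 #|` face S u|; first exact: bal1.
have u0' : - u != 0 by rewrite oppr_eq0.
have [gt1|le1'] := ltnP 1 #|` face S (- u)|; first by rewrite [RHS]bal1 // opprK.
have /fset0Pn[z zS] : S != fset0 by rewrite -cardfs_gt0; lia.
have [a au] := face_ex u zS; have [c cu] := face_ex (- u) zS.
by move: le1 le1'; rewrite (cardfsD1 a (face S u)) (cardfsD1 c (face S (- u))) au cu; lia.
Qed.

(** * The extremal example: two parallel rows of k points *)

Definition ladder_point (p : nat * bool) : 'rV[R]_2 :=
  \row_j (if j == 0 then p.1%:R else p.2%:R).

Definition rail (k : nat) (e : bool) : {fset 'rV[R]_2} :=
  [fset ladder_point (nat_of_ord i, e) | i in 'I_k]%fset.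

Lemma ladder_pointE p : (ladder_point p 0 0 = p.1%:R) * (ladder_point p 0 1 = p.2%:R).
Proof. by rewrite !mxE. Qed.

Lemma railP k e x :
  reflect (exists2 i : nat, (i < k)%N & x = ladder_point (i, e)) (x \in rail k e).
Proof.
apply: (iffP idP) => [/imfsetP[/= i _ ->]|[i ik ->]]; first by exists i.
by apply/imfsetP; exists (Ordinal ik).
Qed.

Lemma card_rail k e : #|` rail k e| = k.
Proof.
rewrite card_imfset /=; first by rewrite -cardE card_ord.
move=> i j h; have := congr1 (fun x => x 0 0) h; rewrite /= !ladder_pointE /=.
by move/eqP; rewrite eqr_nat => /eqP /val_inj.
Qed.

Definition ladder k := (rail k false `|` rail k true)%fset.

Lemma card_ladder k : #|` ladder k| = (2 * k)%N.
Proof.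
rewrite cardfsU !card_rail (_ : _ `&` _ = fset0)%fset ?cardfs0; first by lia.
apply/fsetP => x; rewrite in_fsetI in_fset0; apply/negP => /andP[].
move=> /railP[i _ ->] /railP[j _ h].
have := congr1 (fun x => x 0 1) h; rewrite /= !ladder_pointE /= => /eqP.
by rewrite eq_sym oner_eq0.
Qed.

Lemma ladderP k x : reflect (exists (i : nat) (e : bool),
    (i < k)%N /\ x = ladder_point (i, e)) (x \in ladder k).
Proof.
rewrite in_fsetU; apply: (iffP orP).
  by move=> [] /railP[i ik ->]; [exists i, false|exists i, true].
by move=> [i [[] [ik ->]]]; [right|left]; apply/railP; exists i.
Qed.

(** Points on different rails are antipodal in direction [ey], so an independent set lies on one
    rail. With [k] points it is the whole rail, whose ends are distinct as [k >= 2] and antipodal in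
    direction [ex]. *)
Lemma ladder_antipodal k : (2 <= k)%N -> k_antipodal k (ladder k).
Proof.
move=> k2; apply/k_antipodal_indep => T TS iT; rewrite ltnNge; apply/negP => kT.
pose ex : 'rV[R]_2 := ladder_point (1%N, false).
pose ey : 'rV[R]_2 := ladder_point (0%N, true).
have dx p : dotp ex (ladder_point p) = p.1%:R.
  by rewrite dotp2 !ladder_pointE /= mul1r mul0r addr0.
have dy p : dotp ey (ladder_point p) = p.2%:R.
  by rewrite dotp2 !ladder_pointE /= mul1r mul0r add0r.
have b01 (e : bool) : 0 <= (e%:R : R) <= 1 by case: e; rewrite ?lexx ler01.
have cross i j : (i < k)%N -> (j < k)%N -> ladder_point (i, true) \in T ->
    ladder_point (j, false) \in T -> False.
  move=> ik jk iT' jT; apply: (iT _ _ iT' jT); exists ey; split.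
  - apply/faceP; split; first by apply/ladderP; exists i, true.
    by move=> y /ladderP[i' [e [_ ->]]]; rewrite !dy; case/andP: (b01 e).
  - apply/faceP; split; first by apply/ladderP; exists j, false.
    by move=> y /ladderP[i' [e [_ ->]]]; rewrite !dotpNl !dy lerN2; case/andP: (b01 e).
  - by rewrite !dy ltr01.
have [e Te] : exists e, (T `<=` rail k e)%fset.
  apply: contrapT => /forallNP h.
  have hn e : exists2 i : nat, (i < k)%N & ladder_point (i, ~~ e) \in T.
    have /fsubsetPn[x xT xe] := introN idP (h e).
    have /ladderP[i [e' [ik xE]]] := fsubsetP TS x xT.
    exists i => //; suff <- : e' = ~~ e by rewrite -xE.
    case: (e' =P e) => [ee|]; last by case: e' {xE}; case: e {h xe}.
    by case/negP: xe; apply/railP; exists i; rewrite // -ee.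
  have [i ik iT'] := hn false; have [j jk jT] := hn true.
  exact: cross ik jk iT' jT.
have TE : T = rail k e by apply/eqP; rewrite eqEfcard Te card_rail.
have lt0k : (0 < k)%N by lia.
have ltk : (k.-1 < k)%N by lia.
apply: (iT (ladder_point (k.-1, e)) (ladder_point (0%N, e))).
- by rewrite TE; apply/railP; exists k.-1.
- by rewrite TE; apply/railP; exists 0%N.
exists ex; split.
- apply/faceP; split; first by apply/ladderP; exists k.-1, e.
  by move=> y /ladderP[i [e' [ik ->]]]; rewrite !dx ler_nat /=; lia.
- apply/faceP; split; first by apply/ladderP; exists 0%N, e.
  by move=> y /ladderP[i [e' [ik ->]]]; rewrite !dotpNl !dx lerN2 ler_nat.
- by rewrite !dx ltr_nat /=; lia.
Qed.

End Polygon.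

Unset Implicit Arguments.

Theorem theorem9 (R : realType) (k : nat) (hk : (2 <= k)%N) :
  is_G R k 2 (2 * k)%N /\
  (forall S : {fset 'rV[R]_2},
     (k_antipodal k S /\ #|` S| = (2 * k)%N) <->
     (exists s : nat,
        [/\ (s <= k)%N,
            convex_gon (2 * s)%N (convex_hull [set` S]),
            [set` S] `<=` bd (convex_hull [set` S]),
            #|` S| = (2 * k)%N
          & forall F : set 'rV[R]_2, side (convex_hull [set` S]) F ->
              exists F' : set 'rV[R]_2,
                [/\ side (convex_hull [set` S]) F', F' <> F, parallel_sides F F'
                  & num_points_on S F = num_points_on S F']])).
Proof.
split.
  split; first by exists (ladder R k); split; [apply: ladder_antipodal|apply: card_ladder].
  by move=> S /k_antipodal_indep; apply: indep_card.
move=> S; split=> [[/k_antipodal_indep hS Sk]|[s [_ _ Sbd Sk hF]]].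
  have [nc sup bal] := extremal_structure hk Sk hS.
  by apply: structure_polygon => //; lia.
split=> //; apply/k_antipodal_indep => T TS iT.
have S1 : (1 < #|` S|)%N by lia.
have [nc sup bal] := polygon_structure S1 Sbd hF.
have S0 : S != fset0 by rewrite -cardfs_gt0; lia.
by have := balanced_indep nc sup bal S0 TS iT; lia.
Qed.
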